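(* Let $A\in\mathbb R^{m\times n}$ be nonzero and $b\in\mathbb R^m$. Suppose that $\mathbb E_{T\in\overline\Omega}[TT^\top]$ and $\mathbb E_{S\in\Omega}[SS^\top]$ are positive definite and that $\Omega$ is finite. Let $z^0\in b+\mathrm{Range}(A)$, $x^0\in\mathrm{Range}(A^\top)$, and let $\{x^k\}_{k\ge0}$ be the sequence generated by the stochastic extended iterative method with adaptive heavy ball momentum (defined in the context). Then for every $k\ge1$ (with $\hat\rho_z>0$, so that the quotient below is defined) $$\mathbb E\left[\|x^k-A^\dagger b\|_2^2\right]\le\hat\rho^{\,k}\left(\|x^0-A^\dagger b\|_2^2+\frac{\gamma}{\max\left\{\left|1-\frac{\hat\rho_x}{\hat\rho_z}\right|,\frac1k\right\}}\,\|z^0-b_{\mathrm{Range}(A)^\perp}\|_2^2\right).$$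
   Context: Setting. $(\Omega,\mathcal F,P)$ and $(\overline\Omega,\overline{\mathcal F},\overline P)$ are probability spaces whose elements are real matrices: each $S\in\Omega$ has $m$ rows, each $T\in\overline\Omega$ has $n$ rows. $A^\dagger$ is the Moore–Penrose pseudoinverse; $b_{\mathrm{Range}(A)^\perp}$ is the orthogonal projection of $b$ onto $\mathrm{Range}(A)^\perp$; $\|\cdot\|_2$ is the Euclidean norm for vectors and the spectral norm for matrices. $\sigma_{\min}(\cdot)$, $\lambda_{\min}(\cdot)$ denote the smallest nonzero singular value and eigenvalue; $\lambda_{\max}(\cdot)$ the largest eigenvalue. Algorithm (stochastic extended iterative method with adaptive HBM). Deterministic initial points $z^0\in b+\mathrm{Range}(A)$, $x^0\in\mathrm{Range}(A^\top)$. At each step $k\ge0$ draw $T_k\in\overline\Omega$ according to $\overline P$ and $S_k\in\Omega$ according to $P$ (all draws mutually independent), and put $$p^k=AT_kT_k^\top A^\top z^k,\qquad u^k=S_k^\top(Ax^k-(b-z^{k+1})),\qquad q^k=A^\top S_ku^k.$$ Define the basic step-sizes $$\overline L_k=\frac{\|T_k^\top A^\top z^k\|_2^2}{\|p^k\|_2^2}\ \text{ if } T_k^\top A^\top z^k\ne0,\ \ \overline L_k=0\text{ otherwise};\qquad L_k=\frac{\|u^k\|_2^2}{\|q^k\|_2^2}\ \text{ if } u^k\ne0,\ \ L_k=0\text{ otherwise}.$$ Step $k=0$: $z^1=z^0-\overline L_0p^0$, $x^1=x^0-L_0q^0$, $h^1=-L_0S_0u^0$. Step $k\ge1$, Stage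 I: let $D_k=\|p^k\|_2^2\|z^k-z^{k-1}\|_2^2-\langle p^k,z^k-z^{k-1}\rangle^2$. If $D_k\ne0$ set $$\mu_k=\frac{\|z^k-z^{k-1}\|_2^2\,\|T_k^\top A^\top z^k\|_2^2}{D_k},\qquad \omega_k=\frac{\langle p^k,z^k-z^{k-1}\rangle\,\|T_k^\top A^\top z^k\|_2^2}{D_k};$$ otherwise $\mu_k=\overline L_k$, $\omega_k=0$. Update $z^{k+1}=z^k-\mu_kp^k+\omega_k(z^k-z^{k-1})$. Step $k\ge1$, Stage II: let $E_k=\|q^k\|_2^2\|x^k-x^{k-1}\|_2^2-\langle q^k,x^k-x^{k-1}\rangle^2$. If $E_k\ne0$ (equivalently the affine set $x^k+\mathrm{Span}\{q^k,x^k-x^{k-1}\}$ has dimension 2) set $$\alpha_k=\frac{\|u^k\|_2^2\|x^k-x^{k-1}\|_2^2-\langle q^k,x^k-x^{k-1}\rangle\langle h^k,z^{k+1}-z^k\rangle}{E_k},$$ $$\beta_k=\frac{\|u^k\|_2^2\langle q^k,x^k-x^{k-1}\rangle-\|q^k\|_2^2\langle h^k,z^{k+1}-z^k\rangle}{E_k};$$ otherwise $\alpha_k=L_k$, $\beta_k=0$. Update $x^{k+1}=x^k-\alpha_kq^k+\beta_k(x^k-x^{k-1})$ and $h^{k+1}=-\alpha_kS_ku^k+\beta_kh^k$. Constants. $$H=\mathbb E_{S\in\Omega}\left[\frac{SS^\top}{\|A^\top S\|_2^2}\right],\qquad \overline H=\mathbb E_{T\in\overline\Omega}\left[\frac{TT^\top}{\|AT\|_2^2}\right]$$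 (assumed finite; terms with zero denominator are read as $0$), $$\Lambda_{\min}=\inf_{S\in\Omega,\ A^\top S\ne0}\lambda_{\min}\left(\frac{A^\top SS^\top A}{\|A^\top S\|_2^2}\right),$$ $$\hat\rho_z=1-\sigma_{\min}^2(\overline H^{\frac12}A^\top),\qquad \hat\rho_x=1-\sigma_{\min}^2(H^{\frac12}A),\qquad \hat\rho=\max\{\hat\rho_z,\hat\rho_x\},\qquad \gamma=\frac{\lambda_{\max}(H)}{\Lambda_{\min}}+\frac1{\sigma_{\min}^2(A)}.$$ *)

(* Defs.v *)
(* MathComp / MathComp-Analysis; the reals are an arbitrary [R : realType]. *)
From HB Require Import structures.
From mathcomp Require Export all_boot all_order all_algebra finmap.
From mathcomp Require Export all_classical all_reals all_analysis.

Set Implicit Arguments.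
Unset Strict Implicit.
Unset Printing Implicit Defensive.

Import Order.TTheory GRing.Theory Num.Theory.
Import numFieldNormedType.Exports.

Local Open Scope classical_set_scope.
Local Open Scope ring_scope.

Section LinearAlgebra.
Context {R : realType}.

Definition dot p (u v : 'cV[R]_p) : R := \sum_i u i 0 * v i 0.

(* The library norm on matrices is the sup norm, hence these two. *)
Definition norm2 p (v : 'cV[R]_p) : R := Num.sqrt (dot v v).

Definition singular_value p q (M : 'M[R]_(p, q)) : set R :=
  [set s | 0 <= s /\ eigenvalue (M^T *m M) (s ^+ 2)].

Definition spec_norm p q (M : 'M[R]_(p, q)) : R := sup (singular_value M).

Definition sigma_min p q (M : 'M[R]_(p, q)) : R :=
  inf [set s | singular_value M s /\ s != 0].

(* Only meant for symmetric matrices, whose eigenvalues are all real. *)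
Definition lambda_min p (M : 'M[R]_p) : R :=
  inf [set a | eigenvalue M a /\ a != 0].

Definition lambda_max p (M : 'M[R]_p) : R := sup [set a | eigenvalue M a].

Definition posdef p (M : 'M[R]_p) : Prop :=
  M^T = M /\ forall v : 'cV[R]_p, v != 0 -> 0 < dot v (M *m v).

Definition possemidef p (M : 'M[R]_p) : Prop :=
  M^T = M /\ forall v : 'cV[R]_p, 0 <= dot v (M *m v).

(* The positive semidefinite square root; it exists and is unique for
   positive semidefinite M, and the default value is irrelevant then. *)
Definition psd_sqrt p (M : 'M[R]_p) : 'M[R]_p :=
  xget 0 [set B | possemidef B /\ B *m B = M].

(* The Moore-Penrose inverse, characterised by the four Penrose equations
   ([pinvmx] is an arbitrary generalised inverse). *)
Definition mp_inverse p q (M : 'M[R]_(p, q)) : 'M[R]_(q, p) :=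
  xget 0 [set X | [/\ M *m X *m M = M, X *m M *m X = X,
                      (M *m X)^T = M *m X & (X *m M)^T = X *m M]].

Definition mxrange p q (M : 'M[R]_(p, q)) : set 'cV[R]_p :=
  range (fun y : 'cV[R]_q => M *m y).

Definition orth_compl p (V : set 'cV[R]_p) : set 'cV[R]_p :=
  [set v | forall w, V w -> dot v w = 0].

Definition orth_proj p (V : set 'cV[R]_p) (b : 'cV[R]_p) : 'cV[R]_p :=
  xget 0 [set v | V v /\ orth_compl V (b - v)].

End LinearAlgebra.

(* A matrix with m rows and any number of columns. The elements of the sample
   spaces are such matrices: a sample space is given as a measurable type
   together with the map sending each of its points to the matrix it stands
   for. *)
Definition rowsmx (R : realType) (m : nat) := {q : nat & 'M[R]_(m, q)}.

Definition mat (R : realType) m (S : rowsmx R m) : 'M[R]_(m, tag S) :=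
  tagged S.

Section RandomMatrices.
Context {R : realType}.

Definition padded_entry m (S : rowsmx R m) (i : 'I_m) (j : nat) : R :=
  if insub j is Some j' then mat S i j' else 0.

(* Measurability of every entry, matrices with different numbers of columns
   being compared after padding on the right with null columns. *)
Definition measurable_rowsmx d (W : measurableType d) m (S : W -> rowsmx R m) :=
  forall i j, measurable_fun [set: W] (fun w => padded_entry (S w) i j).

Definition integrable_mx d (W : measurableType d) (P : probability W R) p q
    (M : W -> 'M[R]_(p, q)) :=
  forall i j, P.-integrable [set: W] (fun w => (M w i j)%:E).

Definition expectation_mx d (W : measurableType d) (P : probability W R) p q
    (M : W -> 'M[R]_(p, q)) : 'M[R]_(p, q) :=
  \matrix_(i, j) fine ('E_P[fun w => M w i j])%E.

(* A finite or infinite family of classes of events is mutually independent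
   when the product rule holds along every finite subfamily. *)
Definition mutually_independent d (X : measurableType d)
    (Pr : probability X R) (I : choiceType) (G : I -> set (set X)) :=
  forall (J : {fset I}) (E : I -> set X),
    (forall i, i \in J -> G i (E i)) ->
    Pr (\bigcap_(i in [set` J]) E i) = (\prod_(i <- J) Pr (E i))%E.

Definition draws_events d d1 d2 (X : measurableType d)
    (W1 : measurableType d1) (W2 : measurableType d2)
    (tau : nat -> X -> W1) (sig : nat -> X -> W2) (i : nat + nat) :
    set (set X) :=
  match i with
  | inl k => preimage_set_system [set: X] (tau k) measurable
  | inr k => preimage_set_system [set: X] (sig k) measurable
  end.

End RandomMatrices.

Section Algorithm.
Context {R : realType} {m n : nat}.
Variables (A : 'M[R]_(m, n)) (b : 'cV[R]_m).

Record iterate := Iterate {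
  z_prev : 'cV[R]_m; z_cur : 'cV[R]_m;
  x_prev : 'cV[R]_n; x_cur : 'cV[R]_n;
  h_cur : 'cV[R]_m }.

Definition p_dir (T : rowsmx R n) (z : 'cV[R]_m) : 'cV[R]_m :=
  A *m mat T *m (mat T)^T *m A^T *m z.

Definition u_vec (S : rowsmx R m) (x : 'cV[R]_n) (z' : 'cV[R]_m) :
    'cV[R]_(tag S) :=
  (mat S)^T *m (A *m x - (b - z')).

Definition basic_step p q (u : 'cV[R]_p) (d : 'cV[R]_q) : R :=
  if u == 0 then 0 else norm2 u ^+ 2 / norm2 d ^+ 2.

Definition gram2 p (u v : 'cV[R]_p) : R :=
  norm2 u ^+ 2 * norm2 v ^+ 2 - dot u v ^+ 2.

Definition first_step (T : rowsmx R n) (S : rowsmx R m) (st : iterate) :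
    iterate :=
  let z := z_cur st in
  let x := x_cur st in
  let p := p_dir T z in
  let z' := z - basic_step ((mat T)^T *m A^T *m z) p *: p in
  let u := u_vec S x z' in
  let q := A^T *m mat S *m u in
  let L := basic_step u q in
  Iterate z z' x (x - L *: q) (- (L *: (mat S *m u))).

Definition momentum_step (T : rowsmx R n) (S : rowsmx R m) (st : iterate) :
    iterate :=
  let z := z_cur st in
  let dz := z - z_prev st in
  let x := x_cur st in
  let dx := x - x_prev st in
  let h := h_cur st in
  let p := p_dir T z in
  let r := (mat T)^T *m A^T *m z in
  let D := gram2 p dz in
  let mu := if D != 0 then norm2 dz ^+ 2 * norm2 r ^+ 2 / D
            else basic_step r p in
  let omega := if D != 0 then dot p dz * norm2 r ^+ 2 / D else 0 in
  let z' := z - mu *: p + omega *: dz in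
  let u := u_vec S x z' in
  let q := A^T *m mat S *m u in
  let E := gram2 q dx in
  let alpha :=
    if E != 0
    then (norm2 u ^+ 2 * norm2 dx ^+ 2 - dot q dx * dot h (z' - z)) / E
    else basic_step u q in
  let beta :=
    if E != 0
    then (norm2 u ^+ 2 * dot q dx - norm2 q ^+ 2 * dot h (z' - z)) / E
    else 0 in
  Iterate z z' x (x - alpha *: q + beta *: dx)
          (- (alpha *: (mat S *m u)) + beta *: h).

(* The state after k steps, when the draws are T_0, T_1, ... and
   S_0, S_1, ... At k = 0 the fields z_prev, x_prev and h_cur are dummies,
   which the first step does not read. *)
Fixpoint adaptive_hbm (z0 : 'cV[R]_m) (x0 : 'cV[R]_n)
    (T : nat -> rowsmx R n) (S : nat -> rowsmx R m) (k : nat) : iterate :=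
  match k with
  | 0 => Iterate z0 z0 x0 x0 0
  | k'.+1 =>
      (if k' == 0%N then first_step else momentum_step)
        (T k') (S k') (adaptive_hbm z0 x0 T S k')
  end.

End Algorithm.

Section Constants.
Context {R : realType} {m n : nat}.
Variable A : 'M[R]_(m, n).
Context {d1 d2 : measure_display}.
Context {W1 : measurableType d1} {W2 : measurableType d2}.
Variables (Pbar : probability W1 R) (T : W1 -> rowsmx R n).
Variables (P : probability W2 R) (S : W2 -> rowsmx R m).

(* M M^T / ||B M||_2^2; it is 0 when B M = 0, since 0^-1 = 0. *)
Definition normalized_gram p q (B : 'M[R]_(q, p)) (M : rowsmx R p) : 'M[R]_p :=
  (spec_norm (B *m mat M) ^+ 2)^-1 *: (mat M *m (mat M)^T).

Definition Hmx : 'M[R]_m :=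
  expectation_mx P (fun w => normalized_gram A^T (S w)).

Definition Hbarmx : 'M[R]_n :=
  expectation_mx Pbar (fun w => normalized_gram A (T w)).

Definition Lambda_min : R :=
  inf [set lambda_min ((spec_norm (A^T *m mat (S w)) ^+ 2)^-1 *:
                       (A^T *m mat (S w) *m (mat (S w))^T *m A))
      | w in [set w | A^T *m mat (S w) != 0]].

Definition rho_z : R := 1 - sigma_min (psd_sqrt Hbarmx *m A^T) ^+ 2.

Definition rho_x : R := 1 - sigma_min (psd_sqrt Hmx *m A) ^+ 2.

Definition rho : R := Num.max rho_z rho_x.

Definition gamma : R := lambda_max Hmx / Lambda_min + (sigma_min A ^+ 2)^-1.

End Constants.

(* Main.v *)
Require Import Defs.
From HB Require Import structures.
From mathcomp Require Import measurable_realfun ring.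

(** Write [X = mp_inverse A] for the pseudoinverse, [e_k] for the error of
    [z^k] with respect to the projection of [b] on the orthogonal complement
    of the range of [A], and [f_k] for the error [x^k - X b]. Neither the
    target of the first stage nor the target [X (b - z^(k+1))] of the second
    one is known to the algorithm, but the inner products entering the normal
    equations of their projections are: with [T = T_k], [S = S_k],
    - [p . e_k = |T^T A^T z^k|^2], because [A^T] kills the target of [z];
    - [q . (x^k - X (b - z^(k+1))) = |u|^2], because [b - z^(k+1)] is in the
      range of [A];
    - the inner products with the last displacements are [0] for [z] and
      [h . (z^(k+1) - z^k)] for [x], because the previous step was a
      projection and [A^T h = x^k - x^(k-1)].
    Hence each stage projects its target on an affine set containing the point
    reached by the plain step, which uses the basic step-size and no momentum.
    The relations used here are preserved ([momentum_step_consistent]) and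
    hold at the start, where the first step is a momentum step with null
    displacements ([first_stepE], [adaptive_hbmS]).

    Comparison with the plain step gives, draw by draw, with
    [N(M) = M M^T / |B M|^2] ([normalized_gram]) for [B = A] or [A^T],
    - [|e_(k+1)|^2 <= |e_k|^2 - A^T e_k . N(T) A^T e_k] ([z_step_le]);
    - [|f_(k+1)|^2 <= |f_k|^2 - A f_k . N(S) A f_k
         + Lambda_min^-1 (e_(k+1) . N(S) e_(k+1))
         + sigma_min(A)^-2 |e_(k+1)|^2] ([x_step_le]).
    In the second one the last term bounds the squared distance between the
    moving target [X (b - z^(k+1))] and [X b]; the middle one comes from expanding the
    plain step around [X b], where the two occurrences of the basic step-size
    are bounded from above and from below.

    Since a draw is independent of the past, which determines the vectors in
    these quadratic forms, [N] may be replaced by its expectation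
    ([integral_quad_draw]): a pi-system argument makes the joint law of the
    past and the draw a product ([past_indep]), and Tonelli's theorem applies.
    The errors stay in the ranges of [A] and [A^T], on which the averaged forms
    are at least [1 - rho_z] and [1 - rho_x] times the squared
    norm ([expected_gram_gap]); this needs the range of [B E[N(M)]^(1/2)] to be
    that of [B], which follows from the definiteness of the expectation of
    [M M^T]. Thus
      [E|e_(k+1)|^2 <= rho_z E|e_k|^2] and
      [E|f_(k+1)|^2 <= rho_x E|f_k|^2 + gamma E|e_(k+1)|^2],
    so that [E|f_k|^2] is at most
    [rho_x^k |f_0|^2 + gamma |e_0|^2 sum_(j < k) rho_x^j rho_z^(k - j)], and
    [mixed_geom_le] bounds this sum.

    The spectral facts rest on one lemma, [rayleigh_max]: a symmetric matrix
    attains the maximum of its Rayleigh quotient on an invariant subspace at an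
    eigenvector. It yields the meaning of [lambda_max], [spec_norm],
    [lambda_min] and [sigma_min], and the positive semidefinite square root. *)

Set Implicit Arguments.
Unset Strict Implicit.
Unset Printing Implicit Defensive.
Import Order.TTheory GRing.Theory Num.Theory.
Import numFieldNormedType.Exports.
Local Open Scope classical_set_scope.
Local Open Scope ring_scope.

(** * Inner products and the Rayleigh quotient *)

Section DotProduct.
Context {R : realType}.
Implicit Types p q : nat.

Lemma dotE p (u v : 'cV[R]_p) : dot u v = (u^T *m v) 0 0.
Proof. by rewrite mxE; apply: eq_bigr => i _; rewrite mxE. Qed.

Lemma dotC p (u v : 'cV[R]_p) : dot u v = dot v u.
Proof. by apply: eq_bigr => i _; rewrite mulrC. Qed.

Lemma dotDl p (u v w : 'cV[R]_p) : dot (u + v) w = dot u w + dot v w.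
Proof. by rewrite !dotE linearD/= mulmxDl mxE. Qed.

Lemma dotZl p a (u w : 'cV[R]_p) : dot (a *: u) w = a * dot u w.
Proof. by rewrite !dotE linearZ/= -scalemxAl mxE. Qed.

Lemma dotNl p (u w : 'cV[R]_p) : dot (- u) w = - dot u w.
Proof. by rewrite -scaleN1r dotZl mulN1r. Qed.

Lemma dotDr p (u v w : 'cV[R]_p) : dot u (v + w) = dot u v + dot u w.
Proof. by rewrite dotC dotDl !(dotC u). Qed.

Lemma dotZr p a (u w : 'cV[R]_p) : dot u (a *: w) = a * dot u w.
Proof. by rewrite dotC dotZl dotC. Qed.

Lemma dotNr p (u w : 'cV[R]_p) : dot u (- w) = - dot u w.
Proof. by rewrite dotC dotNl dotC. Qed.

Lemma dot0l p (w : 'cV[R]_p) : dot 0 w = 0.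
Proof. by rewrite -(scale0r 0) dotZl mul0r. Qed.

Lemma dot0r p (w : 'cV[R]_p) : dot w 0 = 0.
Proof. by rewrite dotC dot0l. Qed.

Definition dotLR := (dotDl, dotDr, dotNl, dotNr, dotZl, dotZr, dot0l, dot0r).

Lemma dot_mull p q (M : 'M[R]_(p, q)) u v : dot (M *m u) v = dot u (M^T *m v).
Proof. by rewrite !dotE trmx_mul mulmxA. Qed.

Lemma dot_mulr p q (M : 'M[R]_(p, q)) u v : dot u (M *m v) = dot (M^T *m u) v.
Proof. by rewrite dot_mull trmxK. Qed.

Lemma dotvv_ge0 p (u : 'cV[R]_p) : 0 <= dot u u.
Proof. by apply: sumr_ge0 => i _; rewrite -expr2 sqr_ge0. Qed.

Lemma dotvv_eq0 p (u : 'cV[R]_p) : (dot u u == 0) = (u == 0).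
Proof.
apply/idP/eqP => [|->]; last by rewrite dot0l.
rewrite psumr_eq0 => [/allP u0|i _]; last by rewrite -expr2 sqr_ge0.
apply/colP => i; have := u0 i; rewrite mem_index_enum mxE => /(_ isT) /=.
by rewrite mulf_eq0 orbb => /eqP.
Qed.

Lemma dotvv_gt0 p (u : 'cV[R]_p) : u != 0 -> 0 < dot u u.
Proof. by rewrite lt_def dotvv_eq0 dotvv_ge0 andbT. Qed.

Lemma norm2_sqr p (v : 'cV[R]_p) : norm2 v ^+ 2 = dot v v.
Proof. by rewrite sqr_sqrtr// dotvv_ge0. Qed.

Lemma dot_sqr_le p (u v : 'cV[R]_p) : dot u v ^+ 2 <= dot u u * dot v v.
Proof.
have [->|v0] := eqVneq v 0; first by rewrite !dotLR expr0n mulr0.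
have vv := dotvv_gt0 v0.
have := dotvv_ge0 (dot v v *: u - dot u v *: v).
rewrite !dotLR (dotC v u) => h.
rewrite -(ler_pM2l vv) -subr_ge0; move: h; congr (0 <= _); ring.
Qed.

(** At [t = - b / (c + 1)] the expression is
    [- (b / (c + 1)) ^+ 2 * (c + 2)]. *)
Lemma quad_lin_eq0 (b c : R) :
  0 <= c -> (forall t, 0 <= 2 * t * b + t ^+ 2 * c) -> b = 0.
Proof.
move=> c0 /(_ (- b / (c + 1))) h; apply/eqP/negPn/negP => b0.
have c1 : 0 < c + 1 by rewrite ltr_wpDl.
suff : 2 * (- b / (c + 1)) * b + (- b / (c + 1)) ^+ 2 * c < 0.
  by move=> /(le_lt_trans h); rewrite ltxx.
have -> : 2 * (- b / (c + 1)) * b + (- b / (c + 1)) ^+ 2 * c =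
    - ((b / (c + 1)) ^+ 2 * (c + 2)).
  by field; rewrite gt_eqF.
rewrite oppr_lt0 mulr_gt0//; last by rewrite ltr_wpDl.
by rewrite exprn_even_gt0//= mulf_neq0// invr_eq0 gt_eqF.
Qed.

End DotProduct.

Section Rayleigh.
Context {R : realType}.

Lemma quad_continuous p (K : 'M[R]_p) :
  continuous (fun r : 'rV[R]_p => dot r^T (K *m r^T)).
Proof.
have coord i : continuous (fun r : 'rV[R]_p => r 0 i) by exact: coord_continuous.
have -> : (fun r : 'rV[R]_p => dot r^T (K *m r^T)) =
    (fun r => \sum_i (r 0 i * \sum_j (K i j * r 0 j))).
  apply/funext => r; apply: eq_bigr => i _; rewrite !mxE; congr (_ * _).
  by apply: eq_bigr => j _; rewrite !mxE.
apply: (@continuous_big R^o _ +%R 0) => [|i _ r]; first exact: add_continuous.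
apply: continuousM; first exact: coord.
move: r; apply: (@continuous_big R^o _ +%R 0) => [|j _ r].
  exact: add_continuous.
by apply: continuousM; [exact: cst_continuous|exact: coord].
Qed.

Lemma lin_continuous p q (V : 'M[R]_(q, p)) i :
  continuous (fun r : 'rV[R]_p => (V *m r^T) i 0).
Proof.
have coord j : continuous (fun r : 'rV[R]_p => r 0 j) by exact: coord_continuous.
have -> : (fun r : 'rV[R]_p => (V *m r^T) i 0) =
    (fun r => \sum_j (V i j * r 0 j)).
  by apply/funext => r; rewrite mxE; apply: eq_bigr => j _; rewrite !mxE.
apply: (@continuous_big R^o _ +%R 0) => [|j _ r]; first exact: add_continuous.
by apply: continuousM; [exact: cst_continuous|exact: coord].
Qed.

(** Compactness is about the sup norm of row vectors, which [dot r r = 1]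
    bounds by 1. *)
Lemma sphere_compact p q (V : 'M[R]_(q, p)) :
  compact [set r : 'rV[R]_p | V *m r^T = 0 /\ dot r^T r^T = 1].
Proof.
apply: bounded_closed_compact.
  exists 1; split=> [|M M1 r [_ r1]]; first exact: num_real.
  apply: le_trans _ (ltW M1); rewrite /Num.norm/= mx_normrE.
  apply/bigmax_leP; split=> //= -[i j] _ /=; rewrite (ord1 i).
  rewrite -(@ler_pXn2r _ 2)// ?nnegrE// expr1n -normrX ger0_norm ?sqr_ge0//.
  rewrite -r1 /dot (bigD1 j)//= mxE -expr2 lerDl.
  by apply: sumr_ge0 => k _; rewrite -expr2 sqr_ge0.
have -> : [set r : 'rV[R]_p | V *m r^T = 0 /\ dot r^T r^T = 1] =
   \bigcap_(i in [set: 'I_q])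
      ((fun r : 'rV[R]_p => (V *m r^T) i 0) @^-1` [set 0]) `&`
   ((fun r : 'rV[R]_p => dot r^T (1%:M *m r^T)) @^-1` [set 1]).
  apply/seteqP; split=> r /= [].
    by move=> V0 r1; split; [move=> i _ /=; rewrite V0 mxE|rewrite mul1mx].
  by rewrite mul1mx => V0 r1; split=> //; apply/colP => i; rewrite [LHS]V0// mxE.
apply: closedI.
  apply: closed_bigI => i _; apply: closed_comp => [r _|]; last exact: closed_eq.
  exact: lin_continuous.
by apply: closed_comp => [r _|]; [exact: quad_continuous|exact: closed_eq].
Qed.

(** The maximum of the Rayleigh quotient of [K] on the invariant subspace
    [ker V] is attained by compactness; at a maximiser [c], the form of
    [a - K] is nonnegative on the subspace and vanishes at [c], hence has no
    linear term there, so that [c] is an eigenvector. *)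
Lemma rayleigh_max p q (K : 'M[R]_p) (V : 'M[R]_(q, p)) :
  K^T = K -> (forall v : 'cV_p, V *m v = 0 -> V *m (K *m v) = 0) ->
  (exists2 v : 'cV_p, v != 0 & V *m v = 0) ->
  exists a (v : 'cV_p), [/\ v != 0, V *m v = 0, K *m v = a *: v &
    forall w : 'cV_p, V *m w = 0 -> dot w (K *m w) <= a * dot w w].
Proof.
move=> Ksym VK [v0 v0_neq0 Vv0].
have sq0 : 0 < Num.sqrt (dot v0 v0) by rewrite sqrtr_gt0 dotvv_gt0.
have [] := @EVT_max_rV R p (fun r => dot r^T (K *m r^T))
    [set r : 'rV[R]_p | V *m r^T = 0 /\ dot r^T r^T = 1].
- exists ((Num.sqrt (dot v0 v0))^-1 *: v0)^T => /=; rewrite trmxK; split.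
    by rewrite -scalemxAr Vv0 scaler0.
  by rewrite !dotLR mulrA -expr2 exprVn sqr_sqrtr ?dotvv_ge0// mulVf// dotvv_eq0.
- exact: sphere_compact.
- exact/continuous_subspaceT/quad_continuous.
move=> c; rewrite inE/= => -[Vc c1] cmax.
pose a := dot c^T (K *m c^T).
have amax w : V *m w = 0 -> dot w (K *m w) <= a * dot w w.
  have [->|w0] := eqVneq w 0; first by rewrite mulmx0 !dotLR mulr0.
  move=> Vw; have ww := dotvv_gt0 w0.
  have sw : 0 < Num.sqrt (dot w w) by rewrite sqrtr_gt0.
  have := cmax ((Num.sqrt (dot w w))^-1 *: w)^T.
  rewrite inE/= trmxK -!scalemxAr !dotLR !mulrA -expr2 exprVn.
  rewrite sqr_sqrtr ?dotvv_ge0// (mulrC _^-1 (dot w (K *m w))).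
  rewrite ler_pdivrMr//; apply.
  by rewrite Vw scaler0 mulVf ?gt_eqF.
have K'c w : V *m w = 0 -> dot w (a *: c^T - K *m c^T) = 0.
  move=> Vw; apply: (@quad_lin_eq0 _ _ (a * dot w w - dot w (K *m w))).
    by rewrite subr_ge0 amax.
  move=> t; have := amax (c^T + t *: w).
  rewrite mulmxDr Vc -scalemxAr Vw scaler0 addr0 => /(_ erefl).
  rewrite mulmxDr -scalemxAr !dotLR c1 -/a -subr_ge0.
  have -> : dot c^T (K *m w) = dot w (K *m c^T) by rewrite dot_mulr Ksym dotC.
  by rewrite (dotC c^T w); congr (0 <= _); ring.
exists a, c^T; split=> //.
  by apply: contra_eq_neq c1 => ->; rewrite dot0l eq_sym oner_neq0.
apply/esym/eqP; rewrite -subr_eq0 -dotvv_eq0 K'c//.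
by rewrite mulmxBr -scalemxAr Vc VK// scaler0 subr0.
Qed.

End Rayleigh.

(** * The pseudoinverse and extremal eigenvalues *)

Section PseudoInverse.
Context {R : realType}.

Lemma gram_unitmx p q (M : 'M[R]_(p, q)) : row_free M -> M *m M^T \in unitmx.
Proof.
move=> fM; rewrite -row_free_unit -kermx_eq0; apply/eqP/row_matrixP => i.
rewrite row0; set r := row i _.
have rK : r *m (M *m M^T) = 0 by apply: (sub_kermxP _); exact: row_sub.
have rM : r *m M = 0.
  apply: trmx_inj; rewrite trmx0; apply/eqP.
  by rewrite -dotvv_eq0 dotE trmxK trmx_mul !mulmxA -(mulmxA r) rK mul0mx mxE.
by apply: (row_free_inj fM); rewrite rM mul0mx.
Qed.

(** With [M = C *m F] a full rank factorisation, the pseudoinverse is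
    [F^T (F F^T)^-1 (C^T C)^-1 C^T]. *)
Lemma mp_inverseP p q (M : 'M[R]_(p, q)) (X := mp_inverse M) :
  [/\ M *m X *m M = M, X *m M *m X = X, (M *m X)^T = M *m X &
      (X *m M)^T = X *m M].
Proof.
have -> : X = mp_inverse M by [].
rewrite /mp_inverse; case: xgetP => [Y _ //|nX]; exfalso.
have [r [C [F [CF fF fC]]]] : exists r (C : 'M[R]_(p, r)) (F : 'M[R]_(r, q)),
    [/\ C *m F = M, row_free F & row_free C^T].
  exists (\rank M), (col_base M), (row_base M); split.
  - exact: mulmx_base.
  - exact: row_base_free.
  - by rewrite /row_free mxrank_tr; exact: col_base_full.
pose G := F *m F^T; pose D := C^T *m C.
have uG : G \in unitmx by exact: gram_unitmx.
have uD : D \in unitmx by rewrite /D -{2}(trmxK C) gram_unitmx.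
have Gt : G^T = G by rewrite trmx_mul trmxK.
have Dt : D^T = D by rewrite trmx_mul trmxK.
pose Y := F^T *m (invmx G *m (invmx D *m C^T)).
have MY : M *m Y = C *m (invmx D *m C^T).
  by rewrite -CF /Y !mulmxA -(mulmxA C) mulmxK.
have YM : Y *m M = F^T *m (invmx G *m F).
  by rewrite -CF /Y -!mulmxA (mulmxA C^T) (mulmxA (invmx D)) mulVmx// mul1mx.
apply: (nX Y); split.
- by rewrite MY -CF -!mulmxA (mulmxA C^T) (mulmxA (invmx D)) mulVmx// mul1mx.
- rewrite YM /Y; set E := invmx G *m (invmx D *m C^T).
  by rewrite -!mulmxA (mulmxA F) -/G (mulmxA (invmx G)) mulVmx// mul1mx.
- by rewrite MY !trmx_mul trmxK trmx_inv Dt mulmxA.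
- by rewrite YM !trmx_mul trmxK trmx_inv Gt mulmxA.
Qed.

Lemma mp_inverseK p q (M : 'M[R]_(p, q)) : M *m mp_inverse M *m M = M.
Proof. by have [] := mp_inverseP M. Qed.

Lemma range_mp_inverse p q (M : 'M[R]_(p, q)) v :
  mxrange M v -> M *m (mp_inverse M *m v) = v.
Proof. by move=> [y _ <-]; rewrite !mulmxA mp_inverseK. Qed.

(** With [X = mp_inverse M], this is [X = (X M)^T X = M^T X^T X]. *)
Lemma mp_inverse_range p q (M : 'M[R]_(p, q)) v :
  mxrange M^T (mp_inverse M *m v).
Proof.
have [_ XMX _ XM] := mp_inverseP M.
exists ((mp_inverse M)^T *m (mp_inverse M *m v)) => //.
by rewrite mulmxA -trmx_mul XM mulmxA XMX.
Qed.

(** With [X = mp_inverse M], this is [X = X (M X)^T = X X^T M^T]. *)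
Lemma mp_inverse_ker p q (M : 'M[R]_(p, q)) (v : 'cV[R]_p) :
  M^T *m v = 0 -> mp_inverse M *m v = 0.
Proof.
have [_ XMX MX _] := mp_inverseP M.
move=> Mv; rewrite -XMX -(mulmxA _ M) -MX trmx_mul.
by rewrite -!mulmxA Mv !mulmx0.
Qed.

Lemma tr_mul_proj_compl p q (M : 'M[R]_(p, q)) (b : 'cV[R]_p) :
  M^T *m (b - M *m (mp_inverse M *m b)) = 0.
Proof.
have [MXM _ MXt _] := mp_inverseP M.
have MMX : M^T *m (M *m mp_inverse M) = M^T by rewrite -MXt -trmx_mul MXM.
by rewrite mulmxBr (mulmxA M) (mulmxA M^T) MMX subrr.
Qed.

Lemma orth_complP p q (M : 'M[R]_(p, q)) v :
  orth_compl (mxrange M) v <-> M^T *m v = 0.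
Proof.
split=> [h|Mv w [y _ <-]]; last by rewrite dot_mulr Mv dot0l.
by apply/eqP; rewrite -dotvv_eq0 dot_mull trmxK h//; exists (M^T *m v).
Qed.

(** The characterisation by [xget] determines the projection, since two
    candidates differ by a vector orthogonal to itself. *)
Lemma orth_proj_complE p q (M : 'M[R]_(p, q)) b :
  orth_proj (orth_compl (mxrange M)) b = b - M *m (mp_inverse M *m b).
Proof.
set V := orth_compl _; set v0 := _ - _.
have Vv0 : V v0 by apply/orth_complP; exact: tr_mul_proj_compl.
have Wv0 : orth_compl V (b - v0).
  rewrite opprB addrCA subrr addr0 => w /orth_complP Mw.
  by rewrite dot_mull Mw dot0r.
rewrite /orth_proj; case: xgetP => [v _ [Vv Wv]|/(_ v0)]; last by case.
clearbody v0; apply/eqP; rewrite -subr_eq0 -dotvv_eq0.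
have Vd : V (v - v0).
  by move=> w Mw; rewrite dotDl dotNl Vv// Vv0// subr0.
have -> : dot (v - v0) (v - v0) = dot (b - v0) (v - v0) - dot (b - v) (v - v0).
  by rewrite -dotNl -dotDl opprB [b - v0 + _]addrC addrA subrK.
by rewrite Wv// Wv0// subr0.
Qed.

End PseudoInverse.

Section Spectrum.
Context {R : realType}.

Lemma eigen_tr p (K : 'M[R]_p) a :
  K^T = K -> eigenvalue K a <-> exists2 v : 'cV_p, K *m v = a *: v & v != 0.
Proof.
move=> Kt; split=> [/eigenvalueP[v vK v0]|[v Kv v0]].
  exists v^T; last by rewrite -trmx0 (inj_eq trmx_inj).
  by rewrite -linearZ/= -vK trmx_mul Kt.
apply/eigenvalueP; exists v^T; last by rewrite -trmx0 (inj_eq trmx_inj).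
by rewrite -linearZ/= -Kv trmx_mul Kt.
Qed.

Lemma gram_sym p q (M : 'M[R]_(p, q)) : (M^T *m M)^T = M^T *m M.
Proof. by rewrite trmx_mul trmxK. Qed.

Lemma gram_quad p q (M : 'M[R]_(p, q)) v :
  dot v (M^T *m M *m v) = dot (M *m v) (M *m v).
Proof. by rewrite dot_mull mulmxA. Qed.

Lemma gram_psd p q (M : 'M[R]_(p, q)) : possemidef (M^T *m M).
Proof. by split=> [|v]; rewrite ?gram_sym// gram_quad dotvv_ge0. Qed.

Lemma mulmx_vec_eq0 p q (M : 'M[R]_(p, q)) :
  (forall v : 'cV_q, M *m v = 0) -> M = 0.
Proof.
move=> M0; apply: trmx_inj; apply/row_matrixP => i.
rewrite trmx0 row0 rowE; apply: trmx_inj.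
by rewrite trmx_mul trmxK M0 trmx0.
Qed.

Lemma psd_eigen_ge0 p (K : 'M[R]_p) a :
  possemidef K -> eigenvalue K a -> 0 <= a.
Proof.
move=> [Kt Kpos] /(eigen_tr _ Kt)[w Kw w0].
by have := Kpos w; rewrite Kw dotZr pmulr_lge0 ?dotvv_gt0.
Qed.

(** The range of [K] is the kernel of [1 - K *m mp_inverse K], on which the
    greatest value of the Rayleigh quotient of [- K] is attained. *)
Lemma min_nonzero_eigen p (K : 'M[R]_p) :
  possemidef K -> K != 0 ->
  exists a (v : 'cV_p), [/\ 0 < a, v != 0, K *m v = a *: v &
    forall w, a * dot (K *m w) (K *m w) <= dot (K *m w) (K *m (K *m w))].
Proof.
move=> [Kt Kpos] K0; pose V := 1%:M - K *m mp_inverse K.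
have VK (w : 'cV_p) : V *m (K *m w) = 0.
  by rewrite mulmxBl mul1mx !mulmxA mp_inverseK subrr.
have kerV (v : 'cV_p) : V *m v = 0 -> v = K *m (mp_inverse K *m v).
  by move/eqP; rewrite mulmxBl mul1mx subr_eq0 mulmxA => /eqP.
have [|w _||a [v [v0 Vv Kv amax]]] := @rayleigh_max _ _ _ (- K) V.
- by rewrite linearN/= Kt.
- by rewrite mulNmx mulmxN VK oppr0.
- apply: contrapT => h; move/eqP: K0; apply; apply: mulmx_vec_eq0 => w.
  by apply/eqP/negPn/negP => Kw; apply: h; exists (K *m w).
have Kv' : K *m v = (- a) *: v by rewrite scaleNr -Kv mulNmx opprK.
exists (- a), v; split=> // [|w].
  have vKv : dot v (K *m v) = - a * dot v v by rewrite Kv' !dotLR.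
  have := Kpos v; rewrite vKv pmulr_lge0 ?dotvv_gt0// le_eqVlt => /orP[|//].
  move=> /eqP a0; move: v0; rewrite -dotvv_eq0 {2}(kerV v Vv) dot_mulr Kt Kv'.
  by rewrite -a0 scale0r dot0l eqxx.
have := amax _ (VK w); rewrite mulNmx dotNr lerNl mulNr.
by apply: le_trans; rewrite lexx.
Qed.

(** The value reached in [min_nonzero_eigen] bounds every nonzero eigenvalue
    from below, since an eigenvector [v] for [c != 0] is in the range of
    [K]; so the infimum is attained, and positive. *)
Lemma lambda_minP p (K : 'M[R]_p) (l := lambda_min K) :
  possemidef K -> K != 0 ->
  [/\ 0 < l, eigenvalue K l &
    forall w, l * dot (K *m w) (K *m w) <= dot (K *m w) (K *m (K *m w))].
Proof.
move=> Kpsd K0; have [a [v [a0 v0 Kv amin]]] := min_nonzero_eigen Kpsd K0.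
have eKa : eigenvalue K a by apply/(eigen_tr _ Kpsd.1); exists v.
suff -> : l = a by [].
have lba : lbound [set a | eigenvalue K a /\ a != 0] a.
  move=> c [/(eigen_tr _ Kpsd.1)[w Kw w0] c0].
  have := amin w; rewrite Kw -scalemxAr Kw !dotLR.
  have c2 : 0 < c ^+ 2 * dot w w by rewrite mulr_gt0 ?dotvv_gt0// exprn_even_gt0.
  by move=> h; rewrite -(ler_pM2r c2); move: h; congr (_ <= _); ring.
apply/eqP; rewrite eq_le; apply/andP; split.
  by apply: ge_inf; [exists a|split=> //; rewrite gt_eqF].
by apply: lb_le_inf => //; exists a; split=> //; rewrite gt_eqF.
Qed.

Lemma gram_eq0 p q (M : 'M[R]_(p, q)) : (M^T *m M == 0) = (M == 0).
Proof.
apply/eqP/eqP => [MM|->]; last by rewrite mulmx0.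
apply: mulmx_vec_eq0 => v; apply/eqP.
by rewrite -dotvv_eq0 -gram_quad MM mul0mx dot0r.
Qed.

(** Any [w] may be replaced by its projection on the range of [M]. *)
Lemma gram_range p q (M : 'M[R]_(p, q)) (w : 'cV[R]_p) :
  exists y, M^T *m w = (M^T *m M) *m y.
Proof.
have [_ _ MX _] := mp_inverseP M.
exists (mp_inverse M *m w).
by rewrite -mulmxA (mulmxA M) -MX mulmxA -trmx_mul mp_inverseK.
Qed.

(** By [gram_range], [M^T] and [M^T M] have the same range, so the gap of
    [M^T M] given by [lambda_minP] concerns all vectors [M^T w]; the infimum
    of the singular values is the square root of an attained one. *)
Lemma sigma_minP p q (M : 'M[R]_(p, q)) (s := sigma_min M) :
  M != 0 ->
  [/\ 0 < s, eigenvalue (M^T *m M) (s ^+ 2) &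
   forall w, s ^+ 2 * dot (M^T *m w) (M^T *m w) <=
     dot (M *m (M^T *m w)) (M *m (M^T *m w))].
Proof.
move=> M0; have K0 : M^T *m M != 0 by rewrite gram_eq0.
have [l0 el lmin] := lambda_minP (gram_psd M) K0.
set l := lambda_min _ in l0 el lmin.
have -> : s = Num.sqrt l.
  apply/eqP; rewrite eq_le; apply/andP; split.
    apply: ge_inf; first by exists 0 => x [[]].
    by split; [split; rewrite ?sqrtr_ge0// sqr_sqrtr// ltW|
               rewrite gt_eqF ?sqrtr_gt0].
  apply: lb_le_inf.
    exists (Num.sqrt l).
    by split; [split; rewrite ?sqrtr_ge0// sqr_sqrtr// ltW|
               rewrite gt_eqF ?sqrtr_gt0].
  move=> x [[x0 ex] xn0].
  rewrite -(ger0_norm x0) -sqrtr_sqr ler_wsqrtr//.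
  apply: ge_inf; last by split=> //; rewrite expf_neq0.
  by exists 0 => c [/(psd_eigen_ge0 (gram_psd M))].
rewrite sqr_sqrtr ?ltW// sqrtr_gt0; split=> // w.
have [y ->] := gram_range M w.
by rewrite -(gram_quad M); exact: lmin.
Qed.

Lemma max_eigen p (K : 'M[R]_p) : K^T = K -> (exists v : 'cV[R]_p, v != 0) ->
  exists a, eigenvalue K a /\ forall w, dot w (K *m w) <= a * dot w w.
Proof.
move=> Kt [v v0].
have [u _||a [w [w0 _ Kw amax]]] := @rayleigh_max _ p p K 0 Kt.
- by rewrite mul0mx.
- by exists v => //; rewrite mul0mx.
exists a; split; first by apply/(eigen_tr _ Kt); exists w.
by move=> u; apply: amax; rewrite mul0mx.
Qed.

Lemma eigen_ubound p (K : 'M[R]_p) a : K^T = K ->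
  (forall w, dot w (K *m w) <= a * dot w w) ->
  ubound [set c | eigenvalue K c] a.
Proof.
move=> Kt amax c /(eigen_tr _ Kt)[w Kw w0].
by have := amax w; rewrite Kw dotZr ler_pM2r ?dotvv_gt0.
Qed.

Lemma lambda_max_le p (K : 'M[R]_p) (v : 'cV[R]_p) :
  K^T = K -> dot v (K *m v) <= lambda_max K * dot v v.
Proof.
move=> Kt; have [->|v0] := eqVneq v 0; first by rewrite !dot0l mulr0.
have [|a [ea amax]] := max_eigen Kt; first by exists v.
apply: (le_trans (amax v)); rewrite ler_wpM2r ?dotvv_ge0//.
by apply: ub_le_sup => //; exists a; exact: eigen_ubound.
Qed.

Lemma lambda_max_ge0 p (K : 'M[R]_p) : possemidef K -> 0 <= lambda_max K.
Proof.
move=> [Kt Kpos]; have [[v v0]|nv] := pselect (exists v : 'cV[R]_p, v != 0).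
  have := le_trans (Kpos v) (lambda_max_le v Kt).
  by rewrite pmulr_lge0 ?dotvv_gt0.
rewrite /lambda_max (_ : [set _ | _] = set0) ?sup0// -subset0 => a.
by move=> /(eigen_tr _ Kt)[v _ v0]; apply: nv; exists v.
Qed.

Lemma spec_norm_ge0 p q (M : 'M[R]_(p, q)) : 0 <= spec_norm M.
Proof.
rewrite /spec_norm.
have [hs|/sup_out->//] := pselect (has_sup (singular_value M)).
by have [x xM] := hs.1; apply: le_trans xM.1 (sup_upper_bound hs xM).
Qed.

Lemma spec_normP p q (M : 'M[R]_(p, q)) v :
  dot (M *m v) (M *m v) <= spec_norm M ^+ 2 * dot v v.
Proof.
have [->|v0] := eqVneq v 0; first by rewrite mulmx0 !dot0l mulr0.
have [|a [ea amax]] := max_eigen (gram_sym M); first by exists v.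
have a0 : 0 <= a.
  have := amax v; rewrite gram_quad => /(le_trans (dotvv_ge0 _)).
  by rewrite pmulr_lge0 ?dotvv_gt0.
rewrite -gram_quad; apply: (le_trans (amax v)).
rewrite ler_wpM2r ?dotvv_ge0// -(sqr_sqrtr a0).
rewrite ler_pXn2r ?nnegrE ?sqrtr_ge0 ?spec_norm_ge0//.
apply: ub_le_sup; last by split; rewrite ?sqrtr_ge0// sqr_sqrtr.
exists (Num.sqrt a) => x [x0 ex].
rewrite -(ger0_norm x0) -sqrtr_sqr ler_wsqrtr//.
exact: (eigen_ubound (gram_sym M) amax ex).
Qed.

Lemma spec_norm_eq0 p q (M : 'M[R]_(p, q)) : spec_norm M = 0 -> M = 0.
Proof.
move=> M0; apply: mulmx_vec_eq0 => v; apply/eqP; rewrite -dotvv_eq0.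
by rewrite eq_le dotvv_ge0 andbT; have := spec_normP M v; rewrite M0 expr0n mul0r.
Qed.

Lemma spec_norm_gt0 p q (M : 'M[R]_(p, q)) : M != 0 -> 0 < spec_norm M.
Proof.
rewrite lt_def spec_norm_ge0 andbT; apply: contra => /eqP.
by move/spec_norm_eq0 => ->.
Qed.

(** The nonzero eigenvalues of [c M M^T] are among those of [c M^T M]. *)
Lemma lambda_min_gram_tr p q (M : 'M[R]_(p, q)) c y :
  0 < c -> M != 0 ->
  lambda_min (c *: (M^T *m M)) * dot (M *m y) (M *m y) <=
  c * dot (M^T *m (M *m y)) (M^T *m (M *m y)).
Proof.
move=> c0 M0; set K := c *: _; pose N := c *: (M^T^T *m M^T).
have sc_psd p' q' (M' : 'M[R]_(p', q')) : possemidef (c *: (M'^T *m M')).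
  split=> [|v]; first by rewrite linearZ/= gram_sym.
  by rewrite -scalemxAl dotZr gram_quad mulr_ge0 ?dotvv_ge0 ?ltW.
have N0 : N != 0.
  by rewrite scaler_eq0 gt_eqF// gram_eq0 -trmx0 (inj_eq trmx_inj).
have K0 : K != 0 by rewrite scaler_eq0 gt_eqF// gram_eq0.
have [Kt Kpos] := sc_psd _ _ M.
have [a [v [a0 v0 Nv amin]]] := min_nonzero_eigen (sc_psd _ _ M^T) N0.
have aK : lambda_min K <= a.
  apply: ge_inf.
    by exists 0 => b [/(psd_eigen_ge0 (sc_psd _ _ M))].
  split; last by rewrite gt_eqF.
  apply/(eigen_tr _ Kt); exists (M^T *m v); last first.
    apply/eqP => Mv; move/eqP: Nv.
    rewrite -scalemxAl -mulmxA Mv mulmx0 scaler0 eq_sym scaler_eq0 gt_eqF//=.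
    by move/eqP => v00; rewrite v00 eqxx in v0.
  rewrite [RHS]scalemxAr -Nv trmxK -!scalemxAl -scalemxAr; congr (_ *: _).
  by rewrite !mulmxA.
apply: (@le_trans _ _ (a * dot (M *m y) (M *m y))).
  by rewrite ler_wpM2r ?dotvv_ge0.
have [w Mw] := gram_range M^T y; rewrite trmxK in Mw.
have -> : M *m y = N *m (c^-1 *: w).
  rewrite Mw -scalemxAl -scalemxAr scalerA mulfV ?scale1r ?gt_eqF//.
  by rewrite trmxK.
rewrite -(gram_quad M^T) -(dotZr c) scalemxAl; exact: amin.
Qed.

(** Deflation: removing from [K] the part [a *: v *m v^T] carried by a unit
    eigenvector [v] lowers the rank and keeps the form nonnegative; a square
    root [B'] of the remainder kills [v], so [Num.sqrt a *: v *m v^T] can be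
    added to it without cross terms. *)
Lemma possemidef_sqrt p (K : 'M[R]_p) :
  possemidef K -> exists2 B, possemidef B & B *m B = K.
Proof.
have [r] := ubnP (\rank K); elim: r K => // r IHr K; rewrite ltnS => rK Kpsd.
have [->|K0] := eqVneq K 0.
  by exists 0; rewrite ?mulmx0//; split=> [|v]; rewrite ?trmx0// mul0mx dot0r.
have [Kt Kpos] := Kpsd.
have [a [v' [a0 v'0 Kv' _]]] := min_nonzero_eigen Kpsd K0.
have [v [v1 Kv]] : exists v : 'cV_p, dot v v = 1 /\ K *m v = a *: v.
  exists ((Num.sqrt (dot v' v'))^-1 *: v'); split; last first.
    by rewrite -scalemxAr Kv' !scalerA mulrC.
  rewrite !dotLR mulrA -expr2 exprVn sqr_sqrtr ?dotvv_ge0// mulVf//.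
  by rewrite dotvv_eq0.
pose W := v *m v^T.
have Wt : W^T = W by rewrite trmx_mul trmxK.
have Ww w : W *m w = dot v w *: v.
  rewrite /W -mulmxA [v^T *m w]mx11_scalar -dotE.
  by rewrite mul_mx_scalar.
have vvT : v^T *m v = 1%:M by rewrite [LHS]mx11_scalar -dotE v1.
have WW : W *m W = W by rewrite /W -mulmxA (mulmxA v^T) vvT mul1mx.
pose K' := K - a *: W.
have K'v : K' *m v = 0 by rewrite mulmxBl Kv -scalemxAl Ww v1 scale1r subrr.
have K't : K'^T = K' by rewrite linearB/= linearZ/= Wt Kt.
have K'psd : possemidef K'.
  split=> // w; have := Kpos (w - dot v w *: v).
  set u := w - _; have -> : K *m u = K' *m u.
    rewrite mulmxBl -[in RHS]scalemxAl Ww /u dotDr dotNr dotZr v1 mulr1 subrr.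
    by rewrite scale0r scaler0 subr0.
  rewrite /u mulmxBr -scalemxAr K'v scaler0 subr0 dotDl dotNl dotZl.
  by rewrite (dot_mulr _ v) K't K'v dot0l mulr0 subr0.
have rK' : (\rank K' < r)%N.
  apply: leq_trans rK; suff : (K' < K)%MS by rewrite ltmxErank => /andP[].
  rewrite ltmxE; apply/andP; split.
    have -> : K' = (1%:M - W) *m K.
      rewrite mulmxBl mul1mx /W -mulmxA -[K in v^T *m K]Kt -trmx_mul Kv linearZ/=.
      by rewrite -scalemxAr.
    exact: submxMl.
  apply/negP => /submxP[D KD]; have := v1; move: Kv.
  rewrite KD -mulmxA K'v mulmx0.
  move/esym/eqP; rewrite scaler_eq0 gt_eqF//= => /eqP->.
  by rewrite dot0l => /esym/eqP; rewrite oner_eq0.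
have [B' [B't B'pos] B'2] := IHr _ rK' K'psd.
have B'v : B' *m v = 0.
  by apply/eqP; rewrite -dotvv_eq0 dot_mull B't mulmxA B'2 K'v dot0r.
have B'W : B' *m W = 0 by rewrite /W mulmxA B'v mul0mx.
have WB' : W *m B' = 0 by apply: trmx_inj; rewrite trmx_mul Wt B't B'W trmx0.
exists (B' + Num.sqrt a *: W); first split.
- by rewrite linearD/= linearZ/= Wt B't.
- move=> w; rewrite mulmxDl -scalemxAl Ww !dotLR (dotC w v) -expr2.
  by rewrite addr_ge0// mulr_ge0 ?sqrtr_ge0// sqr_ge0.
rewrite mulmxDl !mulmxDr -!scalemxAr -!scalemxAl B'W WB' WW !scaler0 addr0 add0r.
by rewrite scalerA -expr2 sqr_sqrtr ?ltW// B'2 subrK.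
Qed.

Lemma psd_sqrtP p (K : 'M[R]_p) (B := psd_sqrt K) :
  possemidef K -> possemidef B /\ B *m B = K.
Proof.
move=> Kpsd; have -> : B = psd_sqrt K by [].
rewrite /psd_sqrt; case: xgetP => [//|nB].
by have [C Cpsd C2] := possemidef_sqrt Kpsd; case: (nB C).
Qed.

End Spectrum.

(** * Projections computed by the step-sizes *)

Section Projections.
Context {R : realType}.

Lemma basic_stepE p q (r : 'cV[R]_q) (d : 'cV[R]_p) :
  (r != 0 -> d != 0) -> basic_step r d * dot d d = dot r r.
Proof.
rewrite /basic_step !norm2_sqr; have [->|r0 /(_ isT) d0] := eqVneq r 0.
  by rewrite dot0l mul0r.
by rewrite mulfVK// dotvv_eq0.
Qed.

(** As [basic_step r d = |r|^2 / |d|^2], a bound [|d|^2 <= M |r|^2] makes the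
    step at least [M^-1]; the factor [dot r r] covers [r = 0]. *)
Lemma basic_step_ge p q (r : 'cV[R]_q) (d : 'cV[R]_p) M :
  (r != 0 -> d != 0) -> dot d d <= M * dot r r ->
  M^-1 * dot r r <= basic_step r d * dot r r.
Proof.
move=> rd dM; have [->|r0] := eqVneq r 0; first by rewrite dot0l !mulr0.
rewrite ler_wpM2r ?dotvv_ge0// /basic_step (negbTE r0) !norm2_sqr.
have d0 := dotvv_gt0 (rd r0); have rr := dotvv_gt0 r0.
have M0 : 0 < M by rewrite -(pmulr_lgt0 _ rr) (lt_le_trans d0).
by rewrite ler_pdivlMr// mulrC ler_pdivrMr// mulrC.
Qed.

(** If [D != 0], the coefficients solve the two normal equations by Cramer's
    rule and [e'] is orthogonal to [g] and [d]. Otherwise the step goes along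
    [g] only and makes [e'] orthogonal to it, or does not move if [r = 0].
    Both displacements of the conclusion are then sums of terms that are null
    or orthogonal to [e']. *)
Lemma momentum_orthogonal p q (e g d : 'cV[R]_p) (r : 'cV[R]_q) c
    (D := gram2 g d)
    (mu := if D != 0 then (norm2 r ^+ 2 * norm2 d ^+ 2 - dot g d * c) / D
           else basic_step r g)
    (om := if D != 0 then (norm2 r ^+ 2 * dot g d - norm2 g ^+ 2 * c) / D
           else 0)
    (e' := e - mu *: g + om *: d) :
  dot g e = dot r r -> dot d e = c ->
  dot (e' - e) e' = 0 /\ dot (e - basic_step r g *: g - e') e' = 0.
Proof.
move=> ge de.
suff [og od] : (dot g e' = 0 \/ (mu = 0 /\ basic_step r g = 0)) /\
               (dot d e' = 0 \/ om = 0).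
  have E1 : e' - e = - (mu *: g) + om *: d.
    by rewrite /e'; apply/colP => i; rewrite !mxE; ring.
  have E2 : e - basic_step r g *: g - e' =
      mu *: g - om *: d - basic_step r g *: g.
    by rewrite /e'; apply/colP => i; rewrite !mxE; ring.
  rewrite E1 E2; clearbody e' => {E1 E2}; rewrite !dotLR; split.
    by case: og => [->|[-> _]]; case: od => ->; rewrite ?mulr0 ?mul0r; ring.
  by case: og => [->|[-> ->]]; case: od => ->; rewrite ?mulr0 ?mul0r; ring.
rewrite /e' /mu /om; case: ifP => [D0|_]; last first.
  split; last by right.
  have [r0|r0] := eqVneq r 0.
    by right; rewrite /basic_step r0 eqxx.
  left; rewrite scale0r addr0 !dotLR ge basic_stepE; first by rewrite subrr.
  move=> _; apply: contra_neq r0 => g0.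
  by apply/eqP; rewrite -dotvv_eq0 -ge g0 dot0l.
have DE : D = dot g g * dot d d - dot g d ^+ 2 by rewrite /D /gram2 !norm2_sqr.
rewrite !norm2_sqr; split; left; rewrite !dotLR ?ge ?de ?(dotC d g) DE.
all: by field; rewrite -DE.
Qed.

Lemma pythagoras_le p (u v : 'cV[R]_p) :
  dot (u - v) v = 0 -> dot v v <= dot u u.
Proof.
move=> uv; have -> : u = (u - v) + v by rewrite subrK.
move: (u - v) uv => w wv; rewrite !dotLR (dotC v w) wv addr0 add0r.
by rewrite lerDr dotvv_ge0.
Qed.

End Projections.

(** * One step of the algorithm, draw by draw *)

Section Range.
Context {R : realType}.

Lemma step_displacement (V : zmodType) (a b c : V) : a - b + c - a = - b + c.
Proof. by rewrite addrAC (addrC a) addrK. Qed.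

Lemma mxrangeP p q (M : 'M[R]_(p, q)) y : mxrange M (M *m y).
Proof. by exists y. Qed.

Lemma mxrangeD p q (M : 'M[R]_(p, q)) u v :
  mxrange M u -> mxrange M v -> mxrange M (u + v).
Proof. by move=> [y _ <-] [w _ <-]; exists (y + w) => //; rewrite mulmxDr. Qed.

Lemma mxrangeZ p q (M : 'M[R]_(p, q)) a u : mxrange M u -> mxrange M (a *: u).
Proof. by move=> [y _ <-]; exists (a *: y) => //; rewrite -scalemxAr. Qed.

Lemma mxrangeN p q (M : 'M[R]_(p, q)) u : mxrange M u -> mxrange M (- u).
Proof. by rewrite -scaleN1r; exact: mxrangeZ. Qed.

Lemma mxrangeB p q (M : 'M[R]_(p, q)) u v :
  mxrange M u -> mxrange M v -> mxrange M (u - v).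
Proof. by move=> Mu Mv; apply: mxrangeD => //; exact: mxrangeN. Qed.

(** [mp_inverse M *m v] is in the range of [M^T], where [M] expands norms by at
    least [sigma_min M], and [M] maps it back to [v]. *)
Lemma mp_inverse_norm p q (M : 'M[R]_(p, q)) v : M != 0 -> mxrange M v ->
  dot (mp_inverse M *m v) (mp_inverse M *m v) <=
  (sigma_min M ^+ 2)^-1 * dot v v.
Proof.
move=> M0 Mv; have [s0 _ smin] := sigma_minP M0.
have [w _ Xv] := mp_inverse_range M v; have := smin w.
rewrite Xv range_mp_inverse// => h.
by rewrite mulrC ler_pdivlMr ?exprn_gt0// mulrC.
Qed.

Lemma normalized_gram_quad p q (B : 'M[R]_(q, p)) (M : rowsmx R p) v :
  dot v (normalized_gram B M *m v) =
  (spec_norm (B *m mat M) ^+ 2)^-1 * dot ((mat M)^T *m v) ((mat M)^T *m v).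
Proof. by rewrite -scalemxAl dotZr -mulmxA (dot_mulr (mat M)). Qed.

End Range.

Section Dynamics.
Context {R : realType} {m n : nat}.
Variables (A : 'M[R]_(m, n)) (b : 'cV[R]_m).
Hypothesis A_neq0 : A != 0.

Let bperp := b - A *m (mp_inverse A *m b).
Let xhat := mp_inverse A *m b.

Definition z_err (st : @iterate R m n) : 'cV[R]_m := z_cur st - bperp.
Definition x_err (st : @iterate R m n) : 'cV[R]_n := x_cur st - xhat.

(** The momentum formulas are meant for states satisfying these relations:
    they make the two step coefficients, which only involve known
    quantities, the solutions of the normal equations of the projections of
    [bperp] and of [mp_inverse A *m (b - z)]. *)
Definition consistent (st : @iterate R m n) : Prop :=
  [/\ mxrange A (z_cur st - b) /\ mxrange A (z_cur st - z_prev st),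
      dot (z_cur st - z_prev st) (z_err st) = 0,
      mxrange A^T (x_cur st),
      A^T *m h_cur st = x_cur st - x_prev st &
      dot (x_cur st - x_prev st)
          (x_cur st - mp_inverse A *m (b - z_cur st)) = 0].

Lemma tr_bperp : A^T *m bperp = 0.
Proof. exact: tr_mul_proj_compl. Qed.

Lemma z_err_range (st : @iterate R m n) :
  mxrange A (z_cur st - b) -> mxrange A (z_err st).
Proof.
move=> zb; rewrite /z_err /bperp opprB addrCA addrC.
by apply: mxrangeD => //; exact: mxrangeP.
Qed.

Lemma tr_z_err (st : @iterate R m n) : A^T *m z_err st = A^T *m z_cur st.
Proof. by rewrite mulmxBr tr_bperp subr0. Qed.

Lemma x_err_range (st : @iterate R m n) :
  mxrange A^T (x_cur st) -> mxrange A^T (x_err st).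
Proof. by move=> x; apply: mxrangeB => //; exact: mp_inverse_range. Qed.

(** As [A^T] kills [bperp], so does [mp_inverse A]. *)
Lemma x_target_err (st : @iterate R m n) :
  mp_inverse A *m (b - z_cur st) - xhat = - (mp_inverse A *m z_err st).
Proof.
rewrite [mp_inverse A *m z_err st]mulmxBr (mp_inverse_ker tr_bperp) subr0.
by rewrite mulmxBr addrAC subrr add0r.
Qed.

Lemma residualE (st st' : @iterate R m n) :
  A *m x_cur st - (b - z_cur st') = A *m x_err st + z_err st'.
Proof. by rewrite mulmxBr /z_err /bperp; apply/colP => i; rewrite !mxE; ring. Qed.

Section Step.
Variables (T : rowsmx R n) (S : rowsmx R m) (st : @iterate R m n).
Hypothesis st_ok : consistent st.
Let st' := momentum_step A b T S st.

Let z := z_cur st.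
Let dz := z - z_prev st.
Let p := p_dir A T z.
Let r := (mat T)^T *m A^T *m z.

Lemma p_dirE : p = A *m mat T *m r.
Proof. by rewrite /p /r /p_dir !mulmxA. Qed.

Lemma dot_p_err : dot p (z_err st) = dot r r.
Proof.
rewrite p_dirE -mulmxA dot_mull tr_z_err dot_mull.
by rewrite /r mulmxA.
Qed.

Lemma z_step : z_err st' = z_err st
   - (if gram2 p dz != 0
      then (norm2 r ^+ 2 * norm2 dz ^+ 2 - dot p dz * 0) / gram2 p dz
      else basic_step r p) *: p
   + (if gram2 p dz != 0
      then (norm2 r ^+ 2 * dot p dz - norm2 p ^+ 2 * 0) / gram2 p dz
      else 0) *: dz.
Proof.
rewrite !mulr0 !subr0 (mulrC (norm2 r ^+ 2)) (mulrC (norm2 r ^+ 2)).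
rewrite /z_err /st' /momentum_step/= [LHS]addrAC; congr (_ + _).
exact: addrAC.
Qed.

Lemma z_step_orth :
  dot (z_cur st' - z_cur st) (z_err st') = 0 /\
  dot (z_err st - basic_step r p *: p - z_err st') (z_err st') = 0.
Proof.
have [_ dze _ _ _] := st_ok.
have -> : z_cur st' - z_cur st = z_err st' - z_err st.
  by rewrite /z_err; apply/colP => i; rewrite !mxE; ring.
by rewrite z_step; apply: momentum_orthogonal; [exact: dot_p_err|exact: dze].
Qed.

(** The first stage does at least as well as the plain step, whose gain is
    [|r|^4 / |p|^2 >= |r|^2 / |A T|^2]. *)
Lemma z_step_le : dot (z_err st') (z_err st') <=
  dot (z_err st) (z_err st) -
  dot (A^T *m z_err st) (normalized_gram A T *m (A^T *m z_err st)).
Proof.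
have rp : r != 0 -> p != 0.
  apply: contra_neq => p0; apply/eqP.
  by rewrite -dotvv_eq0 -dot_p_err p0 dot0l.
apply: le_trans (pythagoras_le z_step_orth.2) _.
have -> : dot (z_err st - basic_step r p *: p) (z_err st - basic_step r p *: p)
    = dot (z_err st) (z_err st) - basic_step r p * dot r r.
  have := basic_stepE rp; move: (z_err st) dot_p_err => e pe Lp.
  rewrite !dotLR (dotC e p) pe.
  transitivity (dot e e - basic_step r p *+ 2 * dot r r +
     basic_step r p * (basic_step r p * dot p p)); first ring.
  by rewrite Lp; ring.
rewrite lerD2l lerN2 normalized_gram_quad tr_z_err mulmxA.
by apply: basic_step_ge => //; rewrite p_dirE; exact: spec_normP.
Qed.

Lemma z_step_range :
  mxrange A (z_cur st' - b) /\ mxrange A (z_cur st' - z_cur st).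
Proof.
have [[zb dzA] _ _ _ _] := st_ok.
have zz : mxrange A (z_cur st' - z_cur st).
  rewrite /st' /momentum_step/= step_displacement.
  apply: mxrangeD; last exact: mxrangeZ.
  by apply/mxrangeN/mxrangeZ; rewrite -/z -/p p_dirE -mulmxA; exact: mxrangeP.
split=> //; have -> : z_cur st' - b = (z_cur st' - z_cur st) + (z_cur st - b).
  by rewrite addrA subrK.
exact: mxrangeD.
Qed.

Let x := x_cur st.
Let dx := x - x_prev st.
Let u := u_vec A b S x (z_cur st').
Let q := A^T *m mat S *m u.
Let tgt := mp_inverse A *m (b - z_cur st').
Let v := (mat S)^T *m (A *m x_err st).
Let w := (mat S)^T *m z_err st'.

Lemma u_vecE : u = v + w.
Proof. by rewrite /u /u_vec residualE mulmxDr. Qed.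

Lemma target_range : A *m tgt = b - z_cur st'.
Proof.
rewrite /tgt range_mp_inverse// -opprB; apply: mxrangeN.
by have [] := z_step_range.
Qed.

Lemma u_vec_target : u = (mat S)^T *m A *m (x - tgt).
Proof. by rewrite -mulmxA mulmxBr target_range. Qed.

Lemma dot_q (y : 'cV[R]_n) : dot q y = dot u ((mat S)^T *m (A *m y)).
Proof. by rewrite /q -mulmxA dot_mull dot_mull trmxK. Qed.

Lemma dot_q_target : dot q (x - tgt) = dot u u.
Proof. by rewrite dot_q mulmxA -u_vec_target. Qed.

(** The component of the displacement of the target along [dx] is known:
    [dx = A^T h] and [A tgt = b - z]. *)
Lemma dot_dx_target :
  dot dx (x - tgt) = dot (h_cur st) (z_cur st' - z_cur st).
Proof.
have [[zb _] _ _ hx xorth] := st_ok.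
have -> : x - tgt = (x - mp_inverse A *m (b - z_cur st)) +
    mp_inverse A *m (z_cur st' - z_cur st).
  by rewrite /tgt !mulmxBr; apply/colP => i; rewrite !mxE; ring.
rewrite dotDr xorth add0r /dx /x -hx dot_mull trmxK range_mp_inverse//.
by have [] := z_step_range.
Qed.

Lemma x_step : x_cur st' - tgt = x - tgt
   - (if gram2 q dx != 0
      then (norm2 u ^+ 2 * norm2 dx ^+ 2
            - dot q dx * dot (h_cur st) (z_cur st' - z_cur st)) / gram2 q dx
      else basic_step u q) *: q
   + (if gram2 q dx != 0
      then (norm2 u ^+ 2 * dot q dx
            - norm2 q ^+ 2 * dot (h_cur st) (z_cur st' - z_cur st)) / gram2 q dx
      else 0) *: dx.
Proof. by rewrite [LHS]addrAC; congr (_ + _); exact: addrAC. Qed.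

Lemma x_step_orth :
  dot (x_cur st' - x_cur st) (x_cur st' - tgt) = 0 /\
  dot (x - tgt - basic_step u q *: q - (x_cur st' - tgt)) (x_cur st' - tgt) = 0.
Proof.
have -> : x_cur st' - x_cur st = (x_cur st' - tgt) - (x - tgt).
  by rewrite -/x; apply/colP => i; rewrite !mxE; ring.
rewrite x_step; apply: momentum_orthogonal; first exact: dot_q_target.
exact: dot_dx_target.
Qed.

Lemma h_step : A^T *m h_cur st' = x_cur st' - x_cur st.
Proof.
have [_ _ _ hx _] := st_ok.
have [al [be [-> ->]]] : exists al be,
    h_cur st' = - (al *: (mat S *m u)) + be *: h_cur st /\
    x_cur st' - x_cur st = - (al *: q) + be *: dx.
  by do 2 eexists; split; last rewrite -[RHS](step_displacement x).
by rewrite mulmxDr mulmxN -!scalemxAr hx mulmxA.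
Qed.

Lemma momentum_step_consistent : consistent st'.
Proof.
have [_ _ xA _ _] := st_ok; split; first exact: z_step_range.
- exact: z_step_orth.1.
- by rewrite -(subrK (x_cur st) (x_cur st')) -h_step; apply: mxrangeD => //;
    exact: mxrangeP.
- exact: h_step.
- exact: x_step_orth.1.
Qed.

(** The error of the plain step, which has no momentum. *)
Let f_plain := x_err st - basic_step u q *: q.

(** [x_cur st'] is the projection of [tgt] on an affine set through
    [x - L *: q], so it is as close to [xhat] as that point, up to the distance
    from [tgt] to [xhat]. *)
Lemma x_step_plain :
  dot (x_err st') (x_err st') <= dot f_plain f_plain +
    dot (mp_inverse A *m z_err st') (mp_inverse A *m z_err st').
Proof.
have [_ orth] := x_step_orth.
pose e' := x_cur st' - tgt; pose s := x - tgt - basic_step u q *: q - e'.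
pose y := tgt - xhat.
have -> : mp_inverse A *m z_err st' = - y by rewrite /y /tgt x_target_err opprK.
have -> : x_err st' = e' + y by rewrite /e' /y addrA subrK.
have -> : f_plain = e' + s + y.
  by rewrite /f_plain /s /y /x_err -/x; apply/colP => i; rewrite !mxE; ring.
have : dot s e' = 0 by [].
move: e' s y => e' s y se {orth}.
rewrite -subr_ge0; have := dotvv_ge0 (s + y); congr (0 <= _).
by rewrite !dotLR (dotC y e') (dotC y s) (dotC e' s) se; ring.
Qed.

(** Expanding the square at [x - L *: q] leaves [L (|w|^2 - |v|^2)], and
    [spec_norm (A^T S)^-2 <= L <= lam^-1 spec_norm (A^T S)^-2] unless [u = 0],
    in which case [|v| = |w|]. *)
Lemma x_plain_le lam : 0 < lam -> lam <= 1 ->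
  (A^T *m mat S != 0 ->
    lam <= lambda_min ((spec_norm (A^T *m mat S) ^+ 2)^-1 *:
                       (A^T *m mat S *m (mat S)^T *m A))) ->
  dot f_plain f_plain <= dot (x_err st) (x_err st)
    - dot (A *m x_err st) (normalized_gram A^T S *m (A *m x_err st))
    + lam^-1 * dot (z_err st') (normalized_gram A^T S *m z_err st').
Proof.
move=> lam0 lam1 lamS; rewrite !normalized_gram_quad -/v -/w.
set M := spec_norm _ ^+ 2 in lamS *; set L := basic_step u q.
have uq : u != 0 -> q != 0.
  by apply: contra_neq => q0; apply/eqP; rewrite -dotvv_eq0 -dot_q_target q0 dot0l.
have -> : dot f_plain f_plain = dot (x_err st) (x_err st) - L * dot v v + L * dot w w.
  have Lq : L * dot q q = dot u u by exact: basic_stepE.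
  have qf : dot q (x_err st) = dot u v by rewrite dot_q.
  have -> : dot w w = dot u u - dot u v *+ 2 + dot v v.
    have -> : w = u - v by rewrite u_vecE addrC addKr.
    by rewrite !dotLR (dotC v u); ring.
  rewrite /f_plain -/L; move: (x_err st) qf => f qf.
  rewrite !dotLR (dotC f q) qf.
  transitivity (dot f f - L *+ 2 * dot u v + L * (L * dot q q)); first ring.
  by rewrite Lq; ring.
have [u0|u0] := eqVneq u 0.
  have -> : L = 0 by rewrite /L /basic_step u0 eqxx.
  have -> : dot v v = dot w w.
    have -> : v = - w by apply/eqP; rewrite -addr_eq0 -u_vecE u0.
    by rewrite !dotLR opprK.
  rewrite !mul0r subr0 addr0 -addrA lerDl addrC subr_ge0.
  rewrite ler_peMl ?invf_ge1//.
  by rewrite mulr_ge0 ?dotvv_ge0// invr_ge0 sqr_ge0.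
have q0 := uq u0.
have S0 : A^T *m mat S != 0 by apply: contra_neq q0 => S0; rewrite /q S0 mul0mx.
have M0 : 0 < M by rewrite exprn_gt0// spec_norm_gt0.
have qq := dotvv_gt0 q0; have uu := dotvv_gt0 u0.
have LE : L = dot u u / dot q q by rewrite /L /basic_step (negbTE u0) !norm2_sqr.
rewrite -!addrA lerD2l; apply: lerD.
  rewrite lerN2 ler_wpM2r ?dotvv_ge0// LE ler_pdivlMr// mulrC ler_pdivrMr//.
  by rewrite mulrC; exact: spec_normP.
rewrite mulrA ler_wpM2r ?dotvv_ge0// LE -invfM ler_pdivrMr// mulrC.
rewrite ler_pdivlMr ?(mulr_gt0 lam0 M0)//.
have SA0 : (mat S)^T *m A != 0.
  apply: contra_neq S0 => S0.
  by apply: trmx_inj; rewrite trmx_mul trmxK S0 trmx0.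
have Mi : 0 < M^-1 by rewrite invr_gt0.
have := lambda_min_gram_tr (x - tgt) Mi SA0.
rewrite -u_vec_target trmx_mul trmxK -/q mulmxA => h.
have := le_trans (ler_wpM2r (dotvv_ge0 u) (lamS S0)) h.
rewrite -(ler_pM2l M0) mulrA (mulrA M M^-1) mulfV ?gt_eqF// mul1r -/q.
by rewrite mulrC (mulrC lam).
Qed.

Lemma x_step_le lam : 0 < lam -> lam <= 1 ->
  (A^T *m mat S != 0 ->
    lam <= lambda_min ((spec_norm (A^T *m mat S) ^+ 2)^-1 *:
                       (A^T *m mat S *m (mat S)^T *m A))) ->
  dot (x_err st') (x_err st') <=
    (dot (x_err st) (x_err st)
      - dot (A *m x_err st) (normalized_gram A^T S *m (A *m x_err st)))
    + (lam^-1 * dot (z_err st') (normalized_gram A^T S *m z_err st')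
      + (sigma_min A ^+ 2)^-1 * dot (z_err st') (z_err st')).
Proof.
move=> lam0 lam1 lamS; apply: le_trans x_step_plain _.
rewrite addrA; apply: lerD; first exact: x_plain_le.
by apply: mp_inverse_norm => //; apply: z_err_range; exact: z_step_range.1.
Qed.

End Step.

(** With no previous displacement the momentum terms vanish, so the first step
    is a step of the general form. *)
Lemma first_stepE T S (st : @iterate R m n) :
  z_prev st = z_cur st -> x_prev st = x_cur st -> h_cur st = 0 ->
  first_step A b T S st = momentum_step A b T S st.
Proof.
move=> ez ex eh; rewrite /first_step /momentum_step ez ex eh !subrr.
have gram0 p (v : 'cV[R]_p) : gram2 v 0 = 0.
  by rewrite /gram2 !norm2_sqr !dot0r mulr0 expr0n subr0.
by rewrite !gram0 eqxx/= !scaler0 !addr0.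
Qed.

Variables (z0 : 'cV[R]_m) (x0 : 'cV[R]_n).
Variables (T : nat -> rowsmx R n) (S : nat -> rowsmx R m).
Let state := adaptive_hbm A b z0 x0 T S.

Lemma adaptive_hbmS k :
  state k.+1 = momentum_step A b (T k) (S k) (state k).
Proof. by rewrite /state/=; case: eqP => // ->; exact: first_stepE. Qed.

Lemma adaptive_hbm_consistent k :
  mxrange A (z0 - b) -> mxrange A^T x0 -> consistent (state k).
Proof.
move=> z0A x0A; elim: k => [|k IHk].
  split=> //=; rewrite ?subrr ?dot0l ?mulmx0//; split=> //.
  by exists 0; rewrite ?mulmx0.
by rewrite adaptive_hbmS; exact: momentum_step_consistent.
Qed.

End Dynamics.

(** * Averaging out a draw independent of the past *)

Section Freezing.
Context {dX dH dW : measure_display} {X : measurableType dX}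
  {H : measurableType dH} {W : measurableType dW} {R : realType}.
Variables (Pr : probability X R) (Q : probability W R).
Variables (g : X -> H) (f : X -> W).
Hypotheses (mg : measurable_fun setT g) (mf : measurable_fun setT f).
Hypothesis gf_indep : forall B C, measurable B -> measurable C ->
  Pr (g @^-1` B `&` f @^-1` C) = (Pr (g @^-1` B) * Q C)%E.

(** The joint law of [g] and [f] is a product, so that [f] can be averaged out
    with [g] held fixed. *)
Lemma integral_freezing (k : H * W -> \bar R) :
  measurable_fun [set: (H * W)%type] k -> (forall z, 0 <= k z)%E ->
  (\int[Pr]_x k (g x, f x) = \int[Pr]_x \int[Q]_s k (g x, s))%E.
Proof.
move=> mk k0.
pose gM := isMeasurableFun.Build _ _ _ _ _ mg.
pose g' : {mfun X >-> H} := HB.pack g gM.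
have mphi : measurable_fun setT (fun x => (g x, f x)).
  exact: measurable_fun_pair.
pose phiM := isMeasurableFun.Build _ _ _ _ _ mphi.
pose phi : {mfun X >-> (H * W)%type} := HB.pack (fun x => (g x, f x)) phiM.
transitivity (\int[distribution Pr phi]_z k z)%E.
  by rewrite ge0_integral_pushforward//= preimage_setT.
apply: (@etrans _ _ (\int[distribution Pr g' \x Q]_z k z)%E).
  apply: eq_measure_integral => A mA _; apply/esym.
  exact: product_measure_unique.
rewrite (@fubini_tonelli1 _ _ _ _ _ (distribution Pr g') Q k mk k0).
rewrite ge0_integral_pushforward//=.
- exact: measurable_fun_fubini_tonelli_F.
- by move=> y _; exact: integral_ge0.
Qed.

End Freezing.

Section Past.
Context {d : measure_display} {X : measurableType d} {R : realType}.
Variables (Pr : probability X R) (I : choiceType) (G : I -> set (set X)).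
Hypothesis G_meas : forall i, G i `<=` measurable.
Hypothesis GT : forall i, G i setT.
Hypothesis GI : forall i, setI_closed (G i).

(** A pi-system generating the sigma-algebra of the events known from the
    indices in [J]; finite [J] suffice, as only finitely many draws precede a
    given one. *)
Definition past_events (J : {fset I}) : set (set X) :=
  [set \bigcap_(i in [set` J]) E i |
     E in [set E | forall i, i \in J -> G i (E i)]].

Definition past (J : {fset I}) := g_sigma_algebraType (past_events J).

Lemma past_events_measurable J : past_events J `<=` measurable.
Proof.
move=> _ [E /= GE <-]; apply: fin_bigcap_measurable; first exact: finite_fset.
by move=> i iJ; apply: G_meas; exact: GE.
Qed.

Lemma measurable_past J : measurable_fun setT (id : X -> past J).
Proof.
move=> _ B mB; rewrite setTI preimage_id.
move: mB; apply: smallest_sub; first exact: sigma_algebra_measurable.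
exact: past_events_measurable.
Qed.

Lemma past_member J i C : i \in J -> G i C -> measurable (C : set (past J)).
Proof.
move=> iJ GC; apply: sub_sigma_algebra.
exists (fun j => if j == i then C else setT) => /=.
  by move=> j _; case: eqP => [->|].
apply/seteqP; split=> [x /(_ i iJ)|x Cx j _] /=; first by rewrite eqxx.
by case: ifP.
Qed.

Lemma past_events_setI J : setI_closed (past_events J).
Proof.
move=> _ _ [E /= GE <-] [F /= GF <-]; exists (fun i => E i `&` F i) => /=.
  by move=> i iJ; apply: GI; [exact: GE|exact: GF].
by rewrite bigcapI.
Qed.

Hypothesis G_indep : mutually_independent Pr G.

(** Both sides are measures in [B], so they agree on the sigma-algebra
    generated by the pi-system of finite intersections of past events. *)
Lemma past_indep J i B C : i \notin J -> measurable (B : set (past J)) ->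
  G i C -> Pr (B `&` C) = (Pr B * Pr C)%E.
Proof.
move=> iJ mB GC; have mC : measurable C by exact: G_meas GC.
pose r := NngNum (fine_ge0 (measure_ge0 Pr C)).
have rE : r%:num%:E = Pr C by rewrite /= fineK// fin_num_measure.
rewrite muleC -rE -[LHS]/(mrestr Pr mC B) -[RHS]/(mscale r Pr B).
have sT : past_events J setT.
  exists (fun=> setT) => /=; first by move=> *; exact: GT.
  by apply/seteqP; split.
apply: (g_sigma_algebra_measure_unique (past_events J) _ (fun=> setT)) mB => //.
- exact: past_events_measurable.
- by apply/seteqP; split=> // x _; exists 0%N.
- exact: past_events_setI.
- move=> _ [E /= GE <-]; rewrite /mrestr /mscale /= rE.
  pose F j := if j == i then C else E j.
  have FE j : j \in J -> F j = E j.
    by move=> jJ; rewrite /F; case: eqP => // ji; rewrite -ji jJ in iJ.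
  have iF : F i = C by rewrite /F eqxx.
  have capE : \bigcap_(j in [set` J]) E j = \bigcap_(j in [set` J]) F j.
    by apply: eq_bigcapr => j jJ; rewrite FE.
  have GF j : j \in (i |` J)%fset -> G j (F j).
    by rewrite in_fset1U => /orP[/eqP ->|jJ]; rewrite ?iF// FE//; exact: GE.
  have GFJ j : j \in J -> G j (F j) by move=> jJ; rewrite FE//; exact: GE.
  have := G_indep GF; rewrite big_fsetU1//= iF -G_indep// -capE => <-.
  congr (Pr _); rewrite setIC; apply/seteqP; split => x /=.
    move=> [Cx Ex] j /=; rewrite in_fset1U => /orP[/eqP ->|jJ]; first by rewrite iF.
    by rewrite FE//; exact: Ex.
  move=> h; split; first by rewrite -iF; apply: h; rewrite /= in_fset1U eqxx.
  by move=> j jJ; rewrite -FE//; apply: h; rewrite /= in_fset1U [_ \in _]jJ orbT.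
- by move=> _; rewrite -ge0_fin_numE ?measure_ge0//= /mrestr fin_num_measure// setTI.
Qed.

End Past.

Section QuadraticExpectation.
Context {d : measure_display} {W : measurableType d} {R : realType}.
Variables (Q : probability W R) (p : nat) (N : W -> 'M[R]_p).
Hypothesis N_int : integrable_mx Q N.

Lemma dot_mulE (K : 'M[R]_p) v :
  dot v (K *m v) = \sum_i \sum_j v i 0 * v j 0 * K i j.
Proof.
apply: eq_bigr => i _; rewrite mxE big_distrr/=; apply: eq_bigr => j _.
by rewrite mulrAC mulrA.
Qed.

Lemma integrable_quad v : Q.-integrable setT (fun w => (dot v (N w *m v))%:E).
Proof.
under eq_fun do rewrite dot_mulE -sumEFin.
apply: integrable_sum => // i _.
under eq_fun do rewrite -sumEFin.
apply: integrable_sum => // j _.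
under eq_fun do rewrite EFinM.
exact: integrableZl.
Qed.

Lemma integral_quad v :
  (\int[Q]_w (dot v (N w *m v))%:E = (dot v (expectation_mx Q N *m v))%:E)%E.
Proof.
under eq_integral do rewrite dot_mulE -sumEFin.
rewrite integral_sum//; last first.
  move=> i; under eq_fun do rewrite -sumEFin.
  apply: integrable_sum => // j _.
  by under eq_fun do rewrite EFinM; exact: integrableZl.
rewrite dot_mulE -sumEFin; apply: eq_bigr => i _.
under eq_integral do rewrite -sumEFin.
rewrite integral_sum//; last first.
  by move=> j; under eq_fun do rewrite EFinM; exact: integrableZl.
rewrite -sumEFin; apply: eq_bigr => j _.
under eq_integral do rewrite EFinM.
rewrite integralZl// mxE unlock [in RHS]EFinM fineK//.
exact: integrable_fin_num.
Qed.

Lemma integral_affine_quad c a v :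
  (\int[Q]_w (c + a * dot v (N w *m v))%:E =
   (c + a * dot v (expectation_mx Q N *m v))%:E)%E.
Proof.
under eq_integral do rewrite EFinD EFinM.
rewrite integralD//; last 2 first.
- exact: finite_measure_integrable_cst.
- by apply: integrableZl => //; exact: integrable_quad.
rewrite integral_cst// [X in (_ * X)%E]probability_setT mule1 integralZl ?integral_quad//.
exact: integrable_quad.
Qed.

End QuadraticExpectation.

(** * Measurability of the iterates *)

Section Measurability.
Context {d : measure_display} {Y : measurableType d} {R : realType}.

Definition mx_measurable p q (M : Y -> 'M[R]_(p, q)) :=
  forall i j, measurable_fun setT (fun y => M y i j).

Lemma mx_measurable_cst p q (M : 'M[R]_(p, q)) : mx_measurable (fun=> M).
Proof. by move=> i j; exact: measurable_cst. Qed.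

Lemma mx_measurableD p q (M N : Y -> 'M[R]_(p, q)) :
  mx_measurable M -> mx_measurable N -> mx_measurable (fun y => M y + N y).
Proof.
move=> mM mN i j; under eq_fun do rewrite mxE.
exact: measurable_funD.
Qed.

Lemma mx_measurableZ p q (a : Y -> R) (M : Y -> 'M[R]_(p, q)) :
  measurable_fun setT a -> mx_measurable M ->
  mx_measurable (fun y => a y *: M y).
Proof.
move=> ma mM i j; under eq_fun do rewrite mxE.
exact: measurable_funM.
Qed.

Lemma mx_measurableN p q (M : Y -> 'M[R]_(p, q)) :
  mx_measurable M -> mx_measurable (fun y => - M y).
Proof.
move=> mM; under eq_fun do rewrite -scaleN1r.
by apply: mx_measurableZ => //; exact: measurable_cst.
Qed.

Lemma mx_measurableM p q s (M : Y -> 'M[R]_(p, q)) (N : Y -> 'M[R]_(q, s)) :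
  mx_measurable M -> mx_measurable N -> mx_measurable (fun y => M y *m N y).
Proof.
move=> mM mN i j; under eq_fun do rewrite mxE.
by apply: measurable_sum => k; exact: measurable_funM.
Qed.

Lemma mx_measurable_dot p (u v : Y -> 'cV[R]_p) :
  mx_measurable u -> mx_measurable v ->
  measurable_fun setT (fun y => dot (u y) (v y)).
Proof.
by move=> mu mv; apply: measurable_sum => k; exact: measurable_funM.
Qed.

Lemma measurable_fun_inv (f : Y -> R) :
  measurable_fun setT f -> measurable_fun setT (fun y => (f y)^-1).
Proof.
move=> mf.
(* [powR _ (-1)] is measurable and is the inverse on nonnegative numbers. *)
have -> : (fun y => (f y)^-1) = (fun y => f y * powR (f y ^+ 2) (-1)).
  apply/funext => y; rewrite powR_inv1 ?sqr_ge0//.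
  have [->|fy] := eqVneq (f y) 0; first by rewrite invr0 mul0r.
  by rewrite expr2 invfM mulrA mulfV ?mul1r.
apply: measurable_funM => //.
apply: (measurableT_comp (measurable_powR _)); exact: measurable_funX.
Qed.

Lemma measurable_fun_if0 (D f g : Y -> R) :
  measurable_fun setT D -> measurable_fun setT f -> measurable_fun setT g ->
  measurable_fun setT (fun y => if D y == 0 then f y else g y).
Proof.
move=> mD mf mg; apply: measurable_fun_ifT => //.
by apply: measurable_fun_eqr => //; exact: measurable_cst.
Qed.

End Measurability.

Section GramStep.
Context {R : realType} {m n : nat}.
Variables (A : 'M[R]_(m, n)) (b : 'cV[R]_m).

(** The general step, as a function of what it computes from the draws: the
    direction [p], the squared norm [rr] and the basic step-size [s] of the
    first stage and, for the second one, the same data and [S u] as functions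
    of the new [z]. *)
Definition step_core (st : @iterate R m n) (p : 'cV[R]_m) (rr s : R)
    (Su : 'cV[R]_m -> 'cV[R]_m) (q_ : 'cV[R]_m -> 'cV[R]_n)
    (uu_ s_ : 'cV[R]_m -> R) : @iterate R m n :=
  let z := z_cur st in
  let dz := z - z_prev st in
  let x := x_cur st in
  let dx := x - x_prev st in
  let h := h_cur st in
  let D := gram2 p dz in
  let mu := if D != 0 then norm2 dz ^+ 2 * rr / D else s in
  let omega := if D != 0 then dot p dz * rr / D else 0 in
  let z' := z - mu *: p + omega *: dz in
  let q := q_ z' in
  let E := gram2 q dx in
  let alpha :=
    if E != 0 then (uu_ z' * norm2 dx ^+ 2 - dot q dx * dot h (z' - z)) / E
    else s_ z' in
  let beta :=
    if E != 0 then (uu_ z' * dot q dx - norm2 q ^+ 2 * dot h (z' - z)) / E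
    else 0 in
  Iterate z z' x (x - alpha *: q + beta *: dx)
          (- (alpha *: Su z') + beta *: h).

(** The step depends on [T] and [S] only through [G = T T^T] and [K = S S^T],
    whose sizes are fixed. *)
Definition gram_step (G : 'M[R]_n) (K : 'M[R]_m) (st : @iterate R m n) :=
  let y := A^T *m z_cur st in
  let p := A *m (G *m y) in
  let rr := dot y (G *m y) in
  let w z' := A *m x_cur st - (b - z') in
  let q z' := A^T *m (K *m w z') in
  let uu z' := dot (w z') (K *m w z') in
  step_core st p rr (rr / dot p p) (fun z' => K *m w z') q uu
    (fun z' => uu z' / dot (q z') (q z')).

Lemma basic_step_div p q (u : 'cV[R]_p) (d : 'cV[R]_q) :
  basic_step u d = dot u u / dot d d.
Proof.
rewrite /basic_step !norm2_sqr; case: eqP => [->|//].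
by rewrite dot0l mul0r.
Qed.

Lemma momentum_step_gram T S (st : @iterate R m n) :
  momentum_step A b T S st =
  gram_step (mat T *m (mat T)^T) (mat S *m (mat S)^T) st.
Proof.
pose u z' := u_vec A b S (x_cur st) z'.
pose q z' := A^T *m mat S *m u z'.
pose r := (mat T)^T *m A^T *m z_cur st; pose p := p_dir A T (z_cur st).
transitivity (step_core st p (norm2 r ^+ 2) (basic_step r p)
  (fun z' => mat S *m u z') q (fun z' => norm2 (u z') ^+ 2)
  (fun z' => basic_step (u z') (q z'))); first by [].
have pE : p = A *m (mat T *m (mat T)^T *m (A^T *m z_cur st)).
  by rewrite /p /p_dir !mulmxA.
have uuE k l (M : 'M[R]_(k, l)) w :
    dot (M^T *m w) (M^T *m w) = dot w (M *m M^T *m w).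
  by rewrite -mulmxA (dot_mulr M).
have rrE : dot r r = dot (A^T *m z_cur st)
    (mat T *m (mat T)^T *m (A^T *m z_cur st)) by rewrite /r -mulmxA uuE.
have SuE z' : mat S *m u z' =
    mat S *m (mat S)^T *m (A *m x_cur st - (b - z')) by rewrite mulmxA.
have qE z' : q z' = A^T *m (mat S *m (mat S)^T *m (A *m x_cur st - (b - z'))).
  by rewrite /q -SuE mulmxA.
have uE z' : norm2 (u z') ^+ 2 = dot (A *m x_cur st - (b - z'))
    (mat S *m (mat S)^T *m (A *m x_cur st - (b - z'))) by rewrite norm2_sqr uuE.
have sE z' : basic_step (u z') (q z') = norm2 (u z') ^+ 2 / dot (q z') (q z').
  by rewrite basic_step_div norm2_sqr.
rewrite basic_step_div !norm2_sqr rrE.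
rewrite (funext SuE) (funext sE) (funext uE) (funext qE).
under [X in step_core _ _ _ _ _ _ _ X = _]funext => z' do rewrite uE.
by rewrite pE.
Qed.

End GramStep.

Section StateMeasurability.
Context {d : measure_display} {Y : measurableType d} {R : realType}.
Context {m n : nat}.
Variables (A : 'M[R]_(m, n)) (b : 'cV[R]_m).
Variables (G : Y -> 'M[R]_n) (K : Y -> 'M[R]_m) (st : Y -> @iterate R m n).
Hypothesis mG : mx_measurable G.
Hypothesis mz : mx_measurable (fun y => z_cur (st y)).
Hypothesis mzp : mx_measurable (fun y => z_prev (st y)).

Let mA : mx_measurable (fun _ : Y => A).
Proof. exact: mx_measurable_cst. Qed.
Let mAt : mx_measurable (fun _ : Y => A^T).
Proof. exact: mx_measurable_cst. Qed.

Lemma mx_measurableB p q (M N : Y -> 'M[R]_(p, q)) :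
  mx_measurable M -> mx_measurable N -> mx_measurable (fun y => M y - N y).
Proof. by move=> mM mN; apply: mx_measurableD => //; exact: mx_measurableN. Qed.

Lemma measurable_gram2 p (u v : Y -> 'cV[R]_p) :
  mx_measurable u -> mx_measurable v ->
  measurable_fun setT (fun y => gram2 (u y) (v y)).
Proof.
move=> mu mv; rewrite /gram2; under eq_fun do rewrite !norm2_sqr.
apply: measurable_funB; last exact/measurable_funX/mx_measurable_dot.
by apply: measurable_funM; exact: mx_measurable_dot.
Qed.

Lemma measurable_fun_div (f g : Y -> R) :
  measurable_fun setT f -> measurable_fun setT g ->
  measurable_fun setT (fun y => f y / g y).
Proof. by move=> mf mg; apply: measurable_funM => //; exact: measurable_fun_inv. Qed.

Lemma gram_step_z_measurable :
  mx_measurable (fun y => z_cur (gram_step A b (G y) (K y) (st y))).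
Proof.
pose y_ y := A^T *m z_cur (st y).
have my : mx_measurable y_ by exact: mx_measurableM.
have mGy : mx_measurable (fun y => G y *m y_ y) by exact: mx_measurableM.
have mp : mx_measurable (fun y => A *m (G y *m y_ y)) by exact: mx_measurableM.
have mdz : mx_measurable (fun y => z_cur (st y) - z_prev (st y)).
  exact: mx_measurableB.
have mrr : measurable_fun setT (fun y => dot (y_ y) (G y *m y_ y)).
  exact: mx_measurable_dot.
have mD := measurable_gram2 mp mdz.
apply: mx_measurableD.
  apply: mx_measurableB => //; apply: mx_measurableZ => //.
  under eq_fun do rewrite if_neg norm2_sqr.
  apply: measurable_fun_if0 => //.
    by apply: measurable_fun_div => //; exact: mx_measurable_dot.
  apply: measurable_fun_div => //; apply: measurable_funM => //.
  exact: mx_measurable_dot.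
apply: mx_measurableZ => //.
under eq_fun do rewrite if_neg.
apply: measurable_fun_if0 => //.
apply: measurable_fun_div => //; apply: measurable_funM => //.
exact: mx_measurable_dot.
Qed.

Hypothesis mK : mx_measurable K.
Hypothesis mx : mx_measurable (fun y => x_cur (st y)).
Hypothesis mxp : mx_measurable (fun y => x_prev (st y)).
Hypothesis mh : mx_measurable (fun y => h_cur (st y)).

Lemma gram_step_xh_measurable :
  mx_measurable (fun y => x_cur (gram_step A b (G y) (K y) (st y))) /\
  mx_measurable (fun y => h_cur (gram_step A b (G y) (K y) (st y))).
Proof.
have := gram_step_z_measurable; rewrite /gram_step /step_core/=.
set z' := fun y => _ - _ + _ => mz'.
pose w y := A *m x_cur (st y) - (b - z' y).
have mw : mx_measurable w.
  apply: mx_measurableB; first exact: mx_measurableM.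
  by apply: mx_measurableB => //; exact: mx_measurable_cst.
have mKw : mx_measurable (fun y => K y *m w y) by exact: mx_measurableM.
pose q y := A^T *m (K y *m w y).
have mq : mx_measurable q by exact: mx_measurableM.
pose dx y := x_cur (st y) - x_prev (st y).
have mdx : mx_measurable dx by exact: mx_measurableB.
pose E y := gram2 (q y) (dx y).
have mE : measurable_fun setT E by exact: measurable_gram2.
have mqdx : measurable_fun setT (fun y => dot (q y) (dx y)).
  exact: mx_measurable_dot.
pose uu y := dot (w y) (K y *m w y).
have muu : measurable_fun setT uu by exact: mx_measurable_dot.
pose c y := dot (h_cur (st y)) (z' y - z_cur (st y)).
have mc : measurable_fun setT c.
  by apply: mx_measurable_dot => //; exact: mx_measurableB.
have mal : measurable_fun setT (fun y => if E y != 0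
    then (uu y * norm2 (dx y) ^+ 2 - dot (q y) (dx y) * c y) / E y
    else uu y / dot (q y) (q y)).
  under eq_fun do rewrite if_neg norm2_sqr.
  apply: measurable_fun_if0 => //; apply: measurable_fun_div => //.
    exact: mx_measurable_dot.
  apply: measurable_funB; apply: measurable_funM => //.
  exact: mx_measurable_dot.
have mbe : measurable_fun setT (fun y => if E y != 0
    then (uu y * dot (q y) (dx y) - norm2 (q y) ^+ 2 * c y) / E y else 0).
  under eq_fun do rewrite if_neg norm2_sqr.
  apply: measurable_fun_if0 => //; apply: measurable_fun_div => //.
  apply: measurable_funB; apply: measurable_funM => //.
  exact: mx_measurable_dot.
split; apply: mx_measurableD; try exact: mx_measurableZ.
  by apply: mx_measurableB => //; exact: mx_measurableZ.
by apply: mx_measurableN; exact: mx_measurableZ.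
Qed.

End StateMeasurability.

Section TrajectoryMeasurability.
Context {d : measure_display} {Y : measurableType d} {R : realType}.
Context {m n : nat}.
Variables (A : 'M[R]_(m, n)) (b : 'cV[R]_m) (z0 : 'cV[R]_m) (x0 : 'cV[R]_n).
Variables (T : nat -> Y -> rowsmx R n) (S : nat -> Y -> rowsmx R m).
Let state k y := adaptive_hbm A b z0 x0 (T^~ y) (S^~ y) k.

Let gram_mx p (M : rowsmx R p) := mat M *m (mat M)^T.

Lemma stateS k y : state k.+1 y =
  gram_step A b (gram_mx (T k y)) (gram_mx (S k y)) (state k y).
Proof. by rewrite /state adaptive_hbmS momentum_step_gram. Qed.

Lemma state_z_measurable k :
  (forall j, (j < k)%N -> mx_measurable (fun y => gram_mx (T j y))) ->
  mx_measurable (fun y => z_cur (state k y)) /\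
  mx_measurable (fun y => z_prev (state k y)).
Proof.
elim: k => [_|k IHk mT]; first by split; exact: mx_measurable_cst.
have [mz mzp] : _ /\ _ := IHk (fun j jk => mT j (ltnW jk)).
split; under eq_fun do rewrite stateS; last exact: mz.
by apply: gram_step_z_measurable => //; exact: mT.
Qed.

Lemma state_x_measurable k :
  (forall j, (j < k)%N -> mx_measurable (fun y => gram_mx (T j y))) ->
  (forall j, (j < k)%N -> mx_measurable (fun y => gram_mx (S j y))) ->
  [/\ mx_measurable (fun y => x_cur (state k y)),
      mx_measurable (fun y => x_prev (state k y)) &
      mx_measurable (fun y => h_cur (state k y))].
Proof.
elim: k => [_ _|k IHk mT mS]; first by split; exact: mx_measurable_cst.
have mT' j : (j < k)%N -> mx_measurable (fun y => gram_mx (T j y)).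
  by move=> jk; exact: mT (ltnW jk).
have [mz mzp] := state_z_measurable mT'.
have [mx mxp mh] := IHk mT' (fun j jk => mS j (ltnW jk)).
have [mx' mh'] := gram_step_xh_measurable A b (mT _ (ltnSn k)) mz mzp
  (mS _ (ltnSn k)) mx mxp mh.
split; under eq_fun do rewrite stateS; [exact: mx'|exact: mx|exact: mh'].
Qed.

End TrajectoryMeasurability.

(** * Expected normalized Gram matrices *)

Section NormalizedGram.
Context {R : realType}.

(** By Cauchy-Schwarz,
    [|M^T e|^4 = (e . M M^T e)^2 <= |e|^2 * |M M^T e|^2]. *)
Lemma spec_norm_tr p q (M : 'M[R]_(p, q)) e :
  dot (M^T *m e) (M^T *m e) <= spec_norm M ^+ 2 * dot e e.
Proof.
set t := dot _ _; have t0 : 0 <= t by exact: dotvv_ge0.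
have te : t = dot e (M *m (M^T *m e)) by rewrite dot_mulr.
have : t * t <= spec_norm M ^+ 2 * dot e e * t.
  rewrite -expr2 {1}te; apply: le_trans (dot_sqr_le _ _) _.
  rewrite (mulrC (_ ^+ 2)) -mulrA ler_wpM2l ?dotvv_ge0//.
  exact: spec_normP.
have [->|tn0] := eqVneq t 0.
  by move=> _; rewrite mulr_ge0 ?dotvv_ge0 ?sqr_ge0.
by rewrite ler_pM2r// lt_def tn0.
Qed.

Lemma normalized_gram_ge0 p q (B : 'M[R]_(q, p)) (M : rowsmx R p) v :
  0 <= dot v (normalized_gram B M *m v).
Proof. by rewrite normalized_gram_quad mulr_ge0 ?dotvv_ge0// invr_ge0 sqr_ge0. Qed.

Lemma normalized_gram_le p q (B : 'M[R]_(q, p)) (M : rowsmx R p) e :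
  dot (B^T *m e) (normalized_gram B M *m (B^T *m e)) <= dot e e.
Proof.
rewrite normalized_gram_quad mulmxA -trmx_mul.
have [->|BM0] := eqVneq (B *m mat M) 0.
  by rewrite trmx0 mul0mx dot0l mulr0 dotvv_ge0.
by rewrite mulrC ler_pdivrMr ?exprn_gt0 ?spec_norm_gt0// mulrC spec_norm_tr.
Qed.

Lemma normalized_gram_eq0 p q (B : 'M[R]_(q, p)) (M : rowsmx R p) e :
  dot (B^T *m e) (normalized_gram B M *m (B^T *m e)) = 0 ->
  (mat M)^T *m (B^T *m e) = 0.
Proof.
move=> /eqP; rewrite normalized_gram_quad mulf_eq0 dotvv_eq0 => /orP[|/eqP//].
rewrite invr_eq0 sqrf_eq0 => /eqP /spec_norm_eq0 BM.
by rewrite mulmxA -trmx_mul BM trmx0 mul0mx.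
Qed.

Section Expected.
Context {d : measure_display} {W : measurableType d}.
Variables (Q : probability W R) (p q : nat) (B : 'M[R]_(q, p)).
Variable M : W -> rowsmx R p.
Hypothesis B_neq0 : B != 0.
Hypothesis MM_int : integrable_mx Q (fun w => mat (M w) *m (mat (M w))^T).
Hypothesis MM_posdef :
  posdef (expectation_mx Q (fun w => mat (M w) *m (mat (M w))^T)).
Let N w := normalized_gram B (M w).
Hypothesis N_int : integrable_mx Q N.
Let EN := expectation_mx Q N.

Lemma expected_gram_psd : possemidef EN.
Proof.
split=> [|v].
  apply/matrixP => i j; rewrite !mxE; congr (fine _); congr ('E_Q[_])%E.
  apply/funext => w; have Nt : (N w)^T = N w.
    by rewrite /N /normalized_gram linearZ/= trmx_mul trmxK.
  by rewrite -[in LHS]Nt mxE.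
rewrite -lee_fin -integral_quad//; apply: integral_ge0 => w _.
by rewrite lee_fin; exact: normalized_gram_ge0.
Qed.

(** A null quadratic form makes [|M^T B^T e|^2] vanish almost everywhere, the
    points where [B M = 0] included. *)
Lemma expected_gram_ker e : dot (B^T *m e) (EN *m (B^T *m e)) = 0 -> B^T *m e = 0.
Proof.
set v := B^T *m e => EN0; apply/eqP/negPn/negP => v0.
have := MM_posdef.2 v v0; rewrite -lte_fin -integral_quad//.
rewrite (ae_eq_integral (cst 0%E)) ?integral0 ?ltxx//.
  by have /integrableP[] := integrable_quad MM_int v.
have := integrable_quad N_int v => /integrableP[mN _].
have [h _] := ae_eq_integral_abs Q measurableT mN.
have : (\int[Q]_(w in setT) `|(dot v (N w *m v))%:E| = 0)%E.
  apply: (@etrans _ _ (dot v (EN *m v))%:E); last by rewrite EN0.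
  rewrite -(integral_quad N_int).
  by apply: eq_integral => w _; rewrite gee0_abs// lee_fin normalized_gram_ge0.
move=> /h; apply: filterS => w /(_ I)/= [Nw0] _.
rewrite -mulmxA (dot_mulr (mat (M w))) (normalized_gram_eq0 Nw0) dot0l//.
Qed.

Let Mx := psd_sqrt EN *m B^T.

Lemma sqrt_gram_quad e :
  dot (Mx *m e) (Mx *m e) = dot (B^T *m e) (EN *m (B^T *m e)).
Proof.
have [[Bt _] B2] := psd_sqrtP expected_gram_psd.
by rewrite -mulmxA dot_mull Bt mulmxA B2.
Qed.

Lemma exists_range_neq0 : exists2 e, mxrange B e & e != 0.
Proof.
apply: contrapT => h; move/eqP: B_neq0; apply; apply: mulmx_vec_eq0 => v.
by apply/eqP/negPn/negP => Bv; apply: h; exists (B *m v) => //; exact: mxrangeP.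
Qed.

(** [e - P e], where [P] is the projection on the range of [Mx^T], lies both in
    the range of [B] and in the kernel of [Mx], which is that of [B^T]. *)
Lemma range_sqrt_gram e : mxrange B e -> mxrange Mx^T e.
Proof.
move=> Be; have [Bt _] := (psd_sqrtP expected_gram_psd).1.
pose Pe := mp_inverse Mx *m (Mx *m e).
have PeM : mxrange Mx^T Pe by exact: mp_inverse_range.
have MxPe : Mx *m (e - Pe) = 0.
  by rewrite mulmxBr /Pe (mulmxA (mp_inverse Mx)) mulmxA mulmxA mp_inverseK subrr.
have BePe : B^T *m (e - Pe) = 0.
  by apply: expected_gram_ker; rewrite -sqrt_gram_quad MxPe dot0l.
suff : e - Pe = 0 by move/eqP; rewrite subr_eq0 => /eqP ->.
have [y _ yE] : mxrange B (e - Pe).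
  apply: mxrangeB => //; have [y _ <-] := PeM.
  by rewrite trmx_mul trmxK -mulmxA; exact: mxrangeP.
by apply/eqP; rewrite -dotvv_eq0 -{2}yE dot_mulr BePe dot0l.
Qed.

Lemma sqrt_gram_neq0 : Mx != 0.
Proof.
apply/eqP => Mx0; have [e Be e0] := exists_range_neq0.
by have [y _ ye] := range_sqrt_gram Be; rewrite -ye Mx0 trmx0 mul0mx eqxx in e0.
Qed.

(** By [range_sqrt_gram], [e] has the form [Mx^T *m y] that [sigma_minP] is
    about. *)
Lemma expected_gram_gap e : mxrange B e ->
  sigma_min Mx ^+ 2 * dot e e <= dot (B^T *m e) (EN *m (B^T *m e)).
Proof.
move=> /range_sqrt_gram[y _ <-]; rewrite -sqrt_gram_quad.
by have [_ _] := sigma_minP sqrt_gram_neq0; apply.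
Qed.

Lemma sigma_min_sqrt_gram_le1 : sigma_min Mx ^+ 2 <= 1.
Proof.
have [e Be e0] := exists_range_neq0.
rewrite -(ler_pM2r (dotvv_gt0 e0)) mul1r.
apply: le_trans (expected_gram_gap Be) _.
rewrite -lee_fin -integral_quad//.
have -> : ((dot e e)%:E = \int[Q]_(w in setT) (dot e e)%:E)%E.
  by rewrite integral_cst// [X in (_ * X)%E]probability_setT mule1.
apply: ge0_le_integral => //.
- by move=> w _; rewrite lee_fin; exact: normalized_gram_ge0.
- by have /integrableP[] := integrable_quad N_int (B^T *m e).
- by move=> w _; rewrite lee_fin; exact: normalized_gram_le.
Qed.

Lemma exists_gram_neq0 : exists w, B *m mat (M w) != 0.
Proof.
apply: contrapT => h; have [e [y _ ye] e0] := exists_range_neq0.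
have v0 : B^T *m e != 0.
  by apply: contra_neq e0 => Be; apply/eqP; rewrite -dotvv_eq0 -{2}ye dot_mulr Be dot0l.
have := MM_posdef.2 _ v0; rewrite -lte_fin -integral_quad//.
rewrite integral0_eq ?ltxx// => w _; rewrite -mulmxA (dot_mulr (mat (M w))).
have -> : (mat (M w))^T *m (B^T *m e) = 0.
  rewrite mulmxA -trmx_mul; suff -> : B *m mat (M w) = 0 by rewrite trmx0 mul0mx.
  by apply/eqP/negPn/negP => BM; apply: h; exists w.
by rewrite dot0l.
Qed.

End Expected.

Section LambdaMin.
Context {W : Type} {m n : nat}.
Variables (A : 'M[R]_(m, n)) (S : W -> rowsmx R m).

Let K w := (spec_norm (A^T *m mat (S w)) ^+ 2)^-1 *:
             (A^T *m mat (S w) *m (mat (S w))^T *m A).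

Lemma normalized_gram_tr_psd w : possemidef (K w).
Proof.
have -> : K w = (spec_norm (A^T *m mat (S w)) ^+ 2)^-1 *:
    (((mat (S w))^T *m A)^T *m ((mat (S w))^T *m A)).
  by rewrite /K trmx_mul trmxK !mulmxA.
split=> [|v]; first by rewrite linearZ/= gram_sym.
by rewrite -scalemxAl dotZr gram_quad mulr_ge0 ?dotvv_ge0// invr_ge0 sqr_ge0.
Qed.

Lemma normalized_gram_tr_neq0 w : A^T *m mat (S w) != 0 -> K w != 0.
Proof.
move=> S0; rewrite scaler_eq0 negb_or invr_eq0 sqrf_eq0.
rewrite gt_eqF ?spec_norm_gt0//= -mulmxA.
have -> : A^T *m mat (S w) = ((mat (S w))^T *m A)^T by rewrite trmx_mul trmxK.
rewrite gram_eq0; apply: contra_neq S0 => SA.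
by apply: trmx_inj; rewrite trmx_mul trmxK SA trmx0.
Qed.

Lemma finite_pos_lbound (E : set R) :
  finite_set E -> (forall x, E x -> 0 < x) -> exists2 c, 0 < c & lbound E c.
Proof.
move=> /finite_seqP[s ->]; elim: s => [|x s IHs] s_gt0; first by exists 1.
have [y ys|c c0 cs] := IHs; first by apply: s_gt0; rewrite /= inE [_ \in _]ys orbT.
exists (Num.min c x); first by rewrite lt_min c0 s_gt0//= inE eqxx.
move=> y; rewrite /= inE => /orP[/eqP ->|ys]; first by rewrite ge_min lexx orbT.
by rewrite ge_min cs.
Qed.

Hypothesis W_fin : finite_set [set: W].
Hypothesis S_neq0 : exists w, A^T *m mat (S w) != 0.

Let E := [set lambda_min (K w) | w in [set w | A^T *m mat (S w) != 0]].

(** The finiteness of [W] is what keeps the infimum away from 0. *)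
Lemma Lambda_min_bounds : [/\ 0 < inf E, inf E <= 1 &
  forall w, A^T *m mat (S w) != 0 -> inf E <= lambda_min (K w)].
Proof.
have K0 w : A^T *m mat (S w) != 0 ->
    [/\ 0 < lambda_min (K w) & lambda_min (K w) <= 1].
  move=> /normalized_gram_tr_neq0 S0.
  have Kpsd := normalized_gram_tr_psd w.
  have [l0 /(eigen_tr _ Kpsd.1)[v Kv v0] _] := lambda_minP Kpsd S0.
  split=> //; rewrite -(ler_pM2r (dotvv_gt0 v0)) mul1r -dotZr -Kv.
  have := normalized_gram_le A^T (S w) v; rewrite trmxK; apply: le_trans.
  rewrite normalized_gram_quad /K -scalemxAl dotZr.
  by rewrite !dot_mull trmxK !mulmxA.
have Epos x : E x -> 0 < x by move=> [w /K0[l0 _] <-].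
have [w0 S0] := S_neq0; have E0 : E !=set0 by exists (lambda_min (K w0)), w0.
have [|c c0 Ec] := finite_pos_lbound _ Epos.
  by apply: finite_image; exact: sub_finite_set W_fin.
have infE w : A^T *m mat (S w) != 0 -> inf E <= lambda_min (K w).
  by move=> S1; apply: ge_inf; [exists c|exists w].
split=> //; first exact: lt_le_trans c0 (lb_le_inf E0 Ec).
by have [_ l1] := K0 _ S0; exact: le_trans (infE _ S0) l1.
Qed.

End LambdaMin.
End NormalizedGram.

(** * Sums of mixed powers *)

Section MixedGeometricSum.
Context {R : realType}.

(** The sum of [a ^+ j * c ^+ (k - j)] over [j < k], in the form in which one
    step after another produces it. *)
Fixpoint mixed_geom (a c : R) k : R :=
  if k is k'.+1 then a * mixed_geom a c k' + c ^+ k else 0.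

Lemma mixed_geom_ge0 a c k : 0 <= a -> 0 <= c -> 0 <= mixed_geom a c k.
Proof.
move=> a0 c0; elim: k => //= k IHk.
by rewrite addr_ge0 ?mulr_ge0 ?exprn_ge0.
Qed.

Lemma mixed_geomE a c k : mixed_geom a c k * (c - a) = c * (c ^+ k - a ^+ k).
Proof.
elim: k => [|k IHk] /=; first by rewrite mul0r subrr mulr0.
by rewrite mulrDl -mulrA IHk !exprS; ring.
Qed.

Lemma mixed_geom_le_nat a c k : 0 <= a -> 0 <= c ->
  mixed_geom a c k <= k%:R * Num.max c a ^+ k.
Proof.
move=> a0 c0; elim: k => [|k IHk] /=; first by rewrite mul0r.
rewrite -natr1 mulrDl mul1r; apply: lerD.
  rewrite exprS mulrCA ler_pM ?mixed_geom_ge0//.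
  by rewrite le_max lexx orbT.
by rewrite lerXn2r ?nnegrE// le_max ?c0 ?lexx.
Qed.

(** Each of the [k] terms is at most [Num.max c a ^+ k], which gives the bound
    with [k%:R^-1]; the closed form [mixed_geomE] gives the one with
    [`|1 - a / c|]. *)
Lemma mixed_geom_le a c k : 0 <= a -> 0 < c -> (0 < k)%N ->
  mixed_geom a c k <= Num.max c a ^+ k / Num.max `|1 - a / c| k%:R^-1.
Proof.
move=> a0 c0 k0; have c0' := ltW c0; have kR : 0 < k%:R :> R by rewrite ltr0n.
have M0 : 0 < Num.max `|1 - a / c| (k%:R^-1 : R) by rewrite lt_max invr_gt0 kR orbT.
rewrite ler_pdivlMr//; have [_|_] := leP `|1 - a / c| (k%:R^-1 : R).
  by rewrite ler_pdivrMr// mulrC; exact: mixed_geom_le_nat.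
rewrite -[X in X * _]ger0_norm ?mixed_geom_ge0// -normrM.
have -> : mixed_geom a c k * (1 - a / c) = c ^+ k - a ^+ k.
  have c0n : c != 0 by rewrite gt_eqF.
  by apply: (mulfI c0n); rewrite -mixed_geomE; field.
have ck : c ^+ k <= Num.max c a ^+ k.
  by rewrite lerXn2r ?nnegrE ?le_max ?c0' ?lexx.
have ak : a ^+ k <= Num.max c a ^+ k.
  by rewrite lerXn2r ?nnegrE ?le_max ?a0 ?c0' ?lexx ?orbT.
have ck0 : 0 <= c ^+ k by exact: exprn_ge0.
have ak0 : 0 <= a ^+ k by exact: exprn_ge0.
rewrite ler_norml; apply/andP; split.
  by rewrite lerNl opprB lerBlDr ler_wpDr.
by rewrite lerBlDr ler_wpDr.
Qed.

End MixedGeometricSum.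

(** * The past of a draw *)

Section FrozenQuad.
Context {dX dW : measure_display} {X : measurableType dX}
  {W : measurableType dW} {R : realType}.
Variables (Pr : probability X R) (Q : probability W R).
Variables (I : choiceType) (G : I -> set (set X)) (J : {fset I}) (i : I).
Hypothesis G_meas : forall i, G i `<=` measurable.
Hypothesis GT : forall i, G i setT.
Hypothesis GI : forall i, setI_closed (G i).
Hypothesis G_indep : mutually_independent Pr G.
Variable f : X -> W.
Hypothesis mf : measurable_fun setT f.
Hypothesis Gf : forall C, measurable C -> G i (f @^-1` C).
Hypothesis f_law : forall C, measurable C -> Pr (f @^-1` C) = Q C.
Hypothesis iJ : i \notin J.
Variables (p : nat) (N : W -> 'M[R]_p).
Hypothesis N_int : integrable_mx Q N.
Variables (c : past G J -> R) (a : R) (v : past G J -> 'cV[R]_p).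
Hypothesis mc : measurable_fun setT c.
Hypothesis mv : mx_measurable v.

Let measurable_frozen :
  measurable_fun [set: (past G J * W)%type]
    (fun z => c z.1 + a * dot (v z.1) (N z.2 *m v z.1)).
Proof.
have mv1 : mx_measurable (fun z : (past G J * W)%type => v z.1).
  by move=> k l; exact: measurableT_comp (mv k l) measurable_fst.
apply: measurable_funD; first exact: measurableT_comp mc measurable_fst.
apply: measurable_funM; first exact: measurable_cst.
apply: mx_measurable_dot => //; apply: mx_measurableM => // k l.
have mN : measurable_fun setT (fun s => N s k l).
  by have /integrableP[/measurable_EFinP] := N_int k l.
exact: measurableT_comp mN measurable_snd.
Qed.

Lemma measurable_quad_draw :
  measurable_fun [set: X] (fun w => c w + a * dot (v w) (N (f w) *m v w)).
Proof.
have mg : measurable_fun [set: X] (fun w => (w : past G J, f w)).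
  by apply: measurable_fun_pair => //; exact: measurable_past.
exact: (measurableT_comp measurable_frozen mg).
Qed.

Lemma measurable_quad_mean (K : 'M[R]_p) :
  measurable_fun [set: X] (fun w => c w + a * dot (v w) (K *m v w)).
Proof.
suff mq : measurable_fun [set: past G J]
    (fun w => c w + a * dot (v w) (K *m v w)).
  exact: measurableT_comp mq (measurable_past (J := J) G_meas).
apply: measurable_funD => //; apply: measurable_funM; first exact: measurable_cst.
by apply: mx_measurable_dot => //; apply: mx_measurableM.
Qed.

Hypothesis quad_ge0 : forall w s, 0 <= c w + a * dot (v w) (N s *m v w).

(** With the past frozen, the integrand is affine in the entries of [N], whose
    expectations are those of [expectation_mx Q N]. *)
Lemma integral_quad_draw :
  (\int[Pr]_w (c w + a * dot (v w) (N (f w) *m v w))%:E =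
   \int[Pr]_w (c w + a * dot (v w) (expectation_mx Q N *m v w))%:E)%E.
Proof.
under [RHS]eq_integral do rewrite -(integral_affine_quad N_int).
pose k (z : past G J * W) := (c z.1 + a * dot (v z.1) (N z.2 *m v z.1))%:E.
apply: (@integral_freezing _ _ _ X (past G J) W R Pr Q id f _ mf _ k) => //.
- exact: measurable_past.
- by move=> B C mB mC; rewrite preimage_id (past_indep _ _ _ _ iJ)// ?f_law//; exact: Gf.
- exact/measurable_EFinP.
- by move=> z; rewrite lee_fin.
Qed.

Lemma integral_quad_draw_le r (g : past G J -> R) :
  0 <= r -> measurable_fun setT g -> (forall w, 0 <= g w) ->
  (forall w, c w + a * dot (v w) (expectation_mx Q N *m v w) <= r * g w) ->
  (\int[Pr]_w (c w + a * dot (v w) (N (f w) *m v w))%:E <=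
   r%:E * \int[Pr]_w (g w)%:E)%E.
Proof.
move=> r0 mg g0 mean_le.
have mgX : measurable_fun [set: X] (fun w => (g w)%:E).
  apply/measurable_EFinP.
  exact: measurableT_comp mg (measurable_past (J := J) G_meas).
rewrite integral_quad_draw -ge0_integralZl//; last first.
  by move=> w _; rewrite lee_fin.
apply: ge0_le_integral => //.
- move=> w _; rewrite -(integral_affine_quad N_int); apply: integral_ge0 => s _.
  by rewrite lee_fin.
- exact/measurable_EFinP/measurable_quad_mean.
- exact: measurable_funeM.
- by move=> w _; rewrite -EFinM lee_fin.
Qed.

End FrozenQuad.

Section Draws.
Context {d d1 d2 : measure_display} {X : measurableType d}
  {W1 : measurableType d1} {W2 : measurableType d2} {R : realType}.
Variables (tau : nat -> X -> W1) (sig : nat -> X -> W2).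
Hypothesis mtau : forall j, measurable_fun setT (tau j).
Hypothesis msig : forall j, measurable_fun setT (sig j).
Let G := draws_events tau sig.

Lemma draws_eventsP i C : G i C <->
  match i with
  | inl k => exists2 B, measurable B & C = tau k @^-1` B
  | inr k => exists2 B, measurable B & C = sig k @^-1` B
  end.
Proof.
by case: i => k; split=> -[B mB]; [move<-|move->|move<-|move->]; exists B;
  rewrite ?setTI.
Qed.

Lemma draws_events_measurable i : G i `<=` measurable.
Proof.
case: i => k C /draws_eventsP[B mB ->]; rewrite -[X in measurable X]setTI.
  exact: mtau.
exact: msig.
Qed.

Lemma draws_eventsT i : G i setT.
Proof. by apply/draws_eventsP; case: i => k; exists setT. Qed.

Lemma draws_events_setI i : setI_closed (G i).
Proof.
move=> C D /draws_eventsP GC /draws_eventsP GD; apply/draws_eventsP.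
case: i GC GD => k [B mB ->] [B' mB' ->]; exists (B `&` B') => //;
  exact: measurableI.
Qed.

(** In step [k], the first stage draws when the indices [draws_before k k] are
    past, the second one when [draws_before k.+1 k] are. *)
Definition draws_before k l : {fset nat + nat} :=
  seq_fset tt ([seq inl j | j <- iota 0 k] ++ [seq inr j | j <- iota 0 l]).

Lemma inl_draws_before j k l : (inl j \in draws_before k l) = (j < k)%N.
Proof.
rewrite seq_fsetE mem_cat mem_map => [|? ? []//]; rewrite mem_iota/= add0n.
by rewrite orbC (_ : (_ \in _) = false)//; apply/mapP => -[].
Qed.

Lemma inr_draws_before j k l : (inr j \in draws_before k l) = (j < l)%N.
Proof.
rewrite seq_fsetE mem_cat orbC mem_map => [|? ? []//]; rewrite mem_iota/= add0n.
by rewrite orbC (_ : (_ \in _) = false)//; apply/mapP => -[].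
Qed.

Lemma measurable_past_inl j k l : (j < k)%N ->
  measurable_fun [set: past G (draws_before k l)] (tau j).
Proof.
move=> jk _ B mB; rewrite setTI; apply: (past_member draws_eventsT (i := inl j)).
  by rewrite inl_draws_before.
by apply/draws_eventsP; exists B.
Qed.

Lemma measurable_past_inr j k l : (j < l)%N ->
  measurable_fun [set: past G (draws_before k l)] (sig j).
Proof.
move=> jk _ B mB; rewrite setTI; apply: (past_member draws_eventsT (i := inr j)).
  by rewrite inr_draws_before.
by apply/draws_eventsP; exists B.
Qed.

End Draws.

(** * Convergence in mean *)

Section Convergence.
Context {R : realType} {m n : nat}.
Variables (A : 'M[R]_(m, n)) (b : 'cV[R]_m).
Context {dbar : measure_display} {Omegabar : measurableType dbar}.
Variables (Pbar : probability Omegabar R) (T : Omegabar -> rowsmx R n).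
Context {d : measure_display} {Omega : measurableType d}.
Variables (P : probability Omega R) (S : Omega -> rowsmx R m).
Context {dX : measure_display} {X : measurableType dX}.
Variables (Pr : probability X R).
Variables (tau : nat -> {RV Pr >-> Omegabar}) (sig : nat -> {RV Pr >-> Omega}).
Variables (z0 : 'cV[R]_m) (x0 : 'cV[R]_n).
Hypothesis A_neq0 : A != 0.
Hypothesis Omega_fin : finite_set [set: Omega].
Hypothesis TT_int : integrable_mx Pbar (fun w => mat (T w) *m (mat (T w))^T).
Hypothesis TT_posdef :
  posdef (expectation_mx Pbar (fun w => mat (T w) *m (mat (T w))^T)).
Hypothesis SS_int : integrable_mx P (fun w => mat (S w) *m (mat (S w))^T).
Hypothesis SS_posdef :
  posdef (expectation_mx P (fun w => mat (S w) *m (mat (S w))^T)).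
Hypothesis Hbar_int : integrable_mx Pbar (fun w => normalized_gram A (T w)).
Hypothesis H_int : integrable_mx P (fun w => normalized_gram A^T (S w)).
Hypothesis tau_distr :
  forall j B, measurable B -> distribution Pr (tau j) B = Pbar B.
Hypothesis sig_distr :
  forall j B, measurable B -> distribution Pr (sig j) B = P B.
Hypothesis draws_indep : mutually_independent Pr
  (draws_events (fun j => tau j) (fun j => sig j)).
Hypothesis z0_range : mxrange A (z0 - b).
Hypothesis x0_range : mxrange A^T x0.

Let G := draws_events (fun j => tau j : X -> Omegabar) (fun j => sig j : X -> Omega).
Definition trajectory k w :=
  adaptive_hbm A b z0 x0 (fun j => T (tau j w)) (fun j => S (sig j w)) k.
Definition z_error k w := z_err A b (trajectory k w).
Definition x_error k w := x_err A b (trajectory k w).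

Let mtau j : measurable_fun setT (tau j : X -> Omegabar).
Proof. exact: measurable_funPT. Qed.
Let msig j : measurable_fun setT (sig j : X -> Omega).
Proof. exact: measurable_funPT. Qed.

Let At_neq0 : A^T != 0.
Proof. by rewrite -trmx0 (inj_eq trmx_inj). Qed.

Let state_ok k w : consistent A b (trajectory k w).
Proof. exact: adaptive_hbm_consistent. Qed.

Let mx_integrable_measurable dW (W : measurableType dW) (Q : probability W R)
    p q (M : W -> 'M[R]_(p, q)) : integrable_mx Q M -> mx_measurable M.
Proof. by move=> MI i j; have /integrableP[/measurable_EFinP] := MI i j. Qed.

Let gram_T_measurable j k l : (j < k)%N ->
  mx_measurable (fun w : past G (draws_before k l) =>
    mat (T (tau j w)) *m (mat (T (tau j w)))^T).
Proof.
move=> jk i i'; have mT := mx_integrable_measurable TT_int i i'.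
have mt := @measurable_past_inl _ _ _ X _ _ (fun j => tau j : X -> Omegabar)
  (fun j => sig j : X -> Omega) j k l jk.
exact: measurableT_comp mT mt.
Qed.

Let gram_S_measurable j k l : (j < l)%N ->
  mx_measurable (fun w : past G (draws_before k l) =>
    mat (S (sig j w)) *m (mat (S (sig j w)))^T).
Proof.
move=> jl i i'; have mS := mx_integrable_measurable SS_int i i'.
have ms := @measurable_past_inr _ _ _ X _ _ (fun j => tau j : X -> Omegabar)
  (fun j => sig j : X -> Omega) j k l jl.
exact: measurableT_comp mS ms.
Qed.

Let ez_measurable k l :
  mx_measurable (fun w : past G (draws_before k l) => z_error k w).
Proof.
apply: mx_measurableB; last exact: mx_measurable_cst.
have [|//] := @state_z_measurable _ (past G (draws_before k l)) R m n A b z0 x0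
  (fun j w => T (tau j w)) (fun j w => S (sig j w)) k.
by move=> j jk; exact: gram_T_measurable.
Qed.

Let ex_measurable k l : (k <= l)%N ->
  mx_measurable (fun w : past G (draws_before l k) => x_error k w).
Proof.
move=> kl; apply: mx_measurableB; last exact: mx_measurable_cst.
have [||//] := @state_x_measurable _ (past G (draws_before l k)) R m n A b z0 x0
  (fun j w => T (tau j w)) (fun j w => S (sig j w)) k.
- by move=> j jk; apply: gram_T_measurable; exact: leq_trans jk kl.
- by move=> j jk; exact: gram_S_measurable.
Qed.

Definition mean_z_error k := (\int[Pr]_w (dot (z_error k w) (z_error k w))%:E)%E.
Definition mean_x_error k := (\int[Pr]_w (dot (x_error k w) (x_error k w))%:E)%E.

Let past_id k l : measurable_fun setT (id : X -> past G (draws_before k l)).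
Proof. by apply: measurable_past => i; exact: draws_events_measurable. Qed.

Let sq_measurable (p : nat) k l (v : past G (draws_before k l) -> 'cV[R]_p) :
  mx_measurable v -> measurable_fun [set: X] (fun w => (dot (v w) (v w))%:E).
Proof.
move=> mv; apply/measurable_EFinP; have mvv := mx_measurable_dot mv mv.
exact: measurableT_comp mvv (@past_id k l).
Qed.

(** The current error is determined by the past of the draw, so that the gain
    in [z_step_le] may be averaged over that draw alone. *)
Lemma expected_z_step k :
  (mean_z_error k.+1 <= (rho_z A Pbar T)%:E * mean_z_error k)%E.
Proof.
pose N w := normalized_gram A (T w).
have mez := @ez_measurable k k.
have mAez : mx_measurable (fun w : past G (draws_before k k) => A^T *m z_error k w).
  by apply: mx_measurableM => //; exact: mx_measurable_cst.
have mc := mx_measurable_dot mez mez.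
have GmE := draws_events_measurable mtau msig.
apply: (@le_trans _ _ (\int[Pr]_w (dot (z_error k w) (z_error k w) +
    -1 * dot (A^T *m z_error k w) (N (tau k w) *m (A^T *m z_error k w)))%:E)%E).
  apply: ge0_le_integral => //.
  - by move=> w _; rewrite lee_fin dotvv_ge0.
  - exact: sq_measurable (@ez_measurable k.+1 k).
  - apply/measurable_EFinP.
    exact: (measurable_quad_draw GmE (mtau k) Hbar_int (-1) mc mAez).
  - move=> w _; rewrite lee_fin mulN1r /z_error /trajectory adaptive_hbmS.
    exact: z_step_le (state_ok k w).
apply: (@integral_quad_draw_le _ _ X Omegabar R Pr Pbar _ G (draws_before k k)
  (inl k)) => //.
- exact: draws_eventsT.
- exact: draws_events_setI.
- by move=> C mC; apply/draws_eventsP; exists C.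
- by move=> C mC; exact: tau_distr.
- by rewrite inl_draws_before ltnn.
- by move=> w s; rewrite mulN1r subr_ge0 normalized_gram_le.
- by rewrite subr_ge0; apply: sigma_min_sqrt_gram_le1.
- by move=> w; exact: dotvv_ge0.
- move=> w; rewrite mulN1r mulrBl mul1r lerD2l lerN2.
  apply: expected_gram_gap => //; apply: z_err_range.
  by have [[]] := state_ok k w.
Qed.

Lemma rho_x_ge0 : 0 <= rho_x A P S.
Proof.
have := sigma_min_sqrt_gram_le1 At_neq0 SS_int SS_posdef H_int.
by rewrite trmxK subr_ge0.
Qed.

(** The error of [z] enters the second stage through [lambda_max H / Lambda_min],
    from the plain step, and [sigma_min A ^- 2], from the distance between
    the target and [mp_inverse A *m b]. *)
Lemma expected_x_step k :
  (mean_x_error k.+1 <= (rho_x A P S)%:E * mean_x_error k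
                        + (gamma A P S)%:E * mean_z_error k.+1)%E.
Proof.
pose N w := normalized_gram A^T (S w).
pose lam := Lambda_min A S.
have [lam0 lam1 lamS] : [/\ 0 < lam, lam <= 1 & forall w, A^T *m mat (S w) != 0 ->
    lam <= lambda_min ((spec_norm (A^T *m mat (S w)) ^+ 2)^-1 *:
                       (A^T *m mat (S w) *m (mat (S w))^T *m A))].
  by apply: Lambda_min_bounds => //; exact: exists_gram_neq0 SS_int SS_posdef.
have mez : mx_measurable (fun w : past G (draws_before k.+1 k) => z_error k.+1 w).
  exact: ez_measurable.
have mex : mx_measurable (fun w : past G (draws_before k.+1 k) => x_error k w).
  exact: ex_measurable.
have mAex : mx_measurable (fun w : past G (draws_before k.+1 k) => A *m x_error k w).
  by apply: mx_measurableM => //; exact: mx_measurable_cst.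
have GmE := draws_events_measurable mtau msig.
have mx2 := mx_measurable_dot mex mex.
have mz2 := mx_measurable_dot mez mez.
pose px w := dot (x_error k w) (x_error k w) +
  -1 * dot (A *m x_error k w) (N (sig k w) *m (A *m x_error k w)).
pose pz w := 0 + lam^-1 * dot (z_error k.+1 w) (N (sig k w) *m z_error k.+1 w).
pose p0 w := (sigma_min A ^+ 2)^-1 * dot (z_error k.+1 w) (z_error k.+1 w).
have quadx w s : 0 <= dot (x_error k w) (x_error k w) +
    -1 * dot (A *m x_error k w) (N s *m (A *m x_error k w)).
  rewrite mulN1r subr_ge0.
  by have := normalized_gram_le A^T (S s) (x_error k w); rewrite trmxK.
have px0 w : 0 <= px w by exact: quadx.
have lamV0 : 0 <= lam^-1 by rewrite invr_ge0 ltW.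
have quadz w s : 0 <= 0 + lam^-1 * dot (z_error k.+1 w) (N s *m z_error k.+1 w).
  by rewrite add0r mulr_ge0// normalized_gram_ge0.
have pz0 w : 0 <= pz w by exact: quadz.
have s0 : 0 <= (sigma_min A ^+ 2)^-1 by rewrite invr_ge0 sqr_ge0.
have p00 w : 0 <= p0 w by rewrite mulr_ge0 ?dotvv_ge0.
have mpx : measurable_fun setT (fun w => (px w)%:E).
  apply/measurable_EFinP.
  exact: (measurable_quad_draw GmE (msig k) H_int (-1) mx2 mAex).
have mpz : measurable_fun setT (fun w => (pz w)%:E).
  apply/measurable_EFinP; have mcst := @measurable_cst _ _
    (past G (draws_before k.+1 k)) R setT 0.
  exact: (measurable_quad_draw GmE (msig k) H_int lam^-1 mcst mez).
have mp0 : measurable_fun setT (fun w => (p0 w)%:E).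
  under eq_fun do rewrite EFinM; apply: measurable_funeM.
  exact: sq_measurable mez.
apply: (@le_trans _ _ (\int[Pr]_w ((px w)%:E + ((pz w)%:E + (p0 w)%:E)))%E).
  apply: ge0_le_integral => //.
  - by move=> w _; rewrite lee_fin dotvv_ge0.
  - exact: sq_measurable (ex_measurable (leqnn k.+1)).
  - by apply: emeasurable_funD => //; exact: emeasurable_funD.
  - move=> w _; rewrite -!EFinD lee_fin /px /pz /p0 mulN1r add0r.
    rewrite /x_error /z_error /trajectory !adaptive_hbmS.
    exact: (x_step_le A_neq0 (T (tau k w)) (state_ok k w) lam0 lam1 (lamS _)).
rewrite ge0_integralD//; last 3 first.
- by move=> w _; rewrite lee_fin.
- by move=> w _; rewrite -EFinD lee_fin addr_ge0.
- exact: emeasurable_funD.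
rewrite ge0_integralD//; last 2 first.
- by move=> w _; rewrite lee_fin.
- by move=> w _; rewrite lee_fin.
have GT := @draws_eventsT _ _ _ X _ _ (fun j => tau j : X -> Omegabar)
  (fun j => sig j : X -> Omega).
have GI := @draws_events_setI _ _ _ X _ _ (fun j => tau j : X -> Omegabar)
  (fun j => sig j : X -> Omega).
have Gsig C : measurable C -> G (inr k) (sig k @^-1` C).
  by move=> mC; apply/draws_eventsP; exists C.
have sigE C : measurable C -> Pr (sig k @^-1` C) = P C.
  by move=> mC; exact: sig_distr.
have iJ : inr k \notin draws_before k.+1 k by rewrite inr_draws_before ltnn.
have Hpsd : possemidef (Hmx A P S) by exact: expected_gram_psd.
have -> : ((gamma A P S)%:E * mean_z_error k.+1 = (lambda_max (Hmx A P S) / lam)%:E * mean_z_error k.+1 +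
    (sigma_min A ^+ 2)^-1%:E * mean_z_error k.+1)%E.
  by rewrite -ge0_muleDl// lee_fin// divr_ge0 ?lambda_max_ge0 ?(ltW lam0).
apply: leeD; last apply: leeD.
- apply: (integral_quad_draw_le GmE GT GI draws_indep (msig k) Gsig sigE iJ) => //.
  + exact: rho_x_ge0.
  + by move=> w; exact: dotvv_ge0.
  + move=> w; rewrite mulN1r mulrBl mul1r lerD2l lerN2.
    have := expected_gram_gap At_neq0 SS_int SS_posdef H_int (e := x_error k w).
    rewrite trmxK; apply; apply: x_err_range.
    by have [] := state_ok k w.
- apply: (integral_quad_draw_le GmE GT GI draws_indep (msig k) Gsig sigE iJ) => //.
  + by rewrite divr_ge0 ?lambda_max_ge0 ?(ltW lam0).
  + by move=> w; exact: dotvv_ge0.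
  + move=> w; rewrite add0r [leRHS]mulrAC [leRHS]mulrC ler_wpM2l//.
    exact: lambda_max_le Hpsd.1.
- rewrite /p0; under eq_integral do rewrite EFinM.
  rewrite ge0_integralZl//.
  + exact: sq_measurable mez.
  + by move=> w _; rewrite lee_fin dotvv_ge0.
Qed.

Hypothesis rho_z_gt0 : 0 < rho_z A Pbar T.

Lemma gamma_ge0 : 0 <= gamma A P S.
Proof.
have [lam0 _ _] := Lambda_min_bounds Omega_fin
  (exists_gram_neq0 At_neq0 SS_int SS_posdef).
rewrite addr_ge0 ?invr_ge0 ?sqr_ge0// divr_ge0 ?(ltW lam0)// lambda_max_ge0//.
exact: expected_gram_psd.
Qed.

Let integral_cst_Pr c : (\int[Pr]_w (c%:E : \bar R) = c%:E)%E.
Proof. by rewrite integral_cst// [X in (_ * X)%E]probability_setT mule1. Qed.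

Let Z0 := dot (z0 - (b - A *m (mp_inverse A *m b)))
              (z0 - (b - A *m (mp_inverse A *m b))).
Let X0 := dot (x0 - mp_inverse A *m b) (x0 - mp_inverse A *m b).

Lemma expected_z_le k : (mean_z_error k <= (rho_z A Pbar T ^+ k * Z0)%:E)%E.
Proof.
elim: k => [|k IHk].
  have -> : mean_z_error 0 = Z0%:E by exact: (integral_cst_Pr Z0).
  by rewrite expr0 mul1r.
apply: le_trans (expected_z_step k) _.
by rewrite exprS -mulrA EFinM lee_pmul2l// lte_fin.
Qed.

Lemma expected_x_le k : (mean_x_error k <= (rho_x A P S ^+ k * X0 +
  gamma A P S * mixed_geom (rho_x A P S) (rho_z A Pbar T) k * Z0)%:E)%E.
Proof.
elim: k => [|k IHk].
  have -> : mean_x_error 0 = X0%:E by exact: (integral_cst_Pr X0).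
  by rewrite /= expr0 mul1r mulr0 mul0r addr0.
apply: le_trans (expected_x_step k) _.
have -> : rho_x A P S ^+ k.+1 * X0 +
    gamma A P S * mixed_geom (rho_x A P S) (rho_z A Pbar T) k.+1 * Z0 =
  rho_x A P S * (rho_x A P S ^+ k * X0 +
    gamma A P S * mixed_geom (rho_x A P S) (rho_z A Pbar T) k * Z0) +
  gamma A P S * (rho_z A Pbar T ^+ k.+1 * Z0).
  by rewrite /= exprS; ring.
rewrite [leRHS]EFinD; apply: leeD; rewrite [leRHS]EFinM.
  by apply: lee_wpmul2l => //; rewrite lee_fin rho_x_ge0.
apply: lee_wpmul2l; first by rewrite lee_fin gamma_ge0.
exact: expected_z_le.
Qed.

End Convergence.

Theorem theorem4p1 (R : realType) (m n : nat)
  (A : 'M[R]_(m, n)) (b : 'cV[R]_m)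
  (dbar : measure_display) (Omegabar : measurableType dbar)
  (Pbar : probability Omegabar R) (T : Omegabar -> rowsmx R n)
  (d : measure_display) (Omega : measurableType d)
  (P : probability Omega R) (S : Omega -> rowsmx R m)
  (dX : measure_display) (X : measurableType dX) (Pr : probability X R)
  (tau : nat -> {RV Pr >-> Omegabar}) (sig : nat -> {RV Pr >-> Omega})
  (z0 : 'cV[R]_m) (x0 : 'cV[R]_n) (k : nat)
  (A_neq0 : A != 0)
  (T_meas : measurable_rowsmx T)
  (S_meas : measurable_rowsmx S)
  (Omega_fin : finite_set [set: Omega])
  (TT_int : integrable_mx Pbar (fun w => mat (T w) *m (mat (T w))^T))
  (TT_posdef : posdef (expectation_mx Pbar
                         (fun w => mat (T w) *m (mat (T w))^T)))
  (SS_int : integrable_mx P (fun w => mat (S w) *m (mat (S w))^T))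
  (SS_posdef : posdef (expectation_mx P
                         (fun w => mat (S w) *m (mat (S w))^T)))
  (Hbar_int : integrable_mx Pbar (fun w => normalized_gram A (T w)))
  (H_int : integrable_mx P (fun w => normalized_gram A^T (S w)))
  (tau_distr : forall j B, measurable B -> distribution Pr (tau j) B = Pbar B)
  (sig_distr : forall j B, measurable B -> distribution Pr (sig j) B = P B)
  (draws_indep : mutually_independent Pr
                   (draws_events (fun j => tau j) (fun j => sig j)))
  (z0_range : mxrange A (z0 - b))
  (x0_range : mxrange A^T x0)
  (rho_z_gt0 : 0 < rho_z A Pbar T)
  (k_gt0 : (0 < k)%N) :
  ('E_Pr[fun w => (norm2
           (x_cur (adaptive_hbm A b z0 x0 (fun j => T (tau j w))
                     (fun j => S (sig j w)) k)
            - mp_inverse A *m b) ^+ 2)%R]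
   <= (rho A Pbar T P S ^+ k *
       (norm2 (x0 - mp_inverse A *m b) ^+ 2
        + gamma A P S
            / Num.max `|1 - rho_x A P S / rho_z A Pbar T| (k%:R^-1)
          * norm2 (z0 - orth_proj (orth_compl (mxrange A)) b) ^+ 2))%R%:E)%E.
Proof.
have Ex := expected_x_le A_neq0 Omega_fin TT_int TT_posdef SS_int SS_posdef
  Hbar_int H_int tau_distr sig_distr draws_indep z0_range x0_range rho_z_gt0 k.
have rx0 := rho_x_ge0 A_neq0 SS_int SS_posdef H_int.
have g0 := gamma_ge0 A_neq0 Omega_fin SS_int SS_posdef H_int.
have -> : ('E_Pr[fun w => (norm2 (x_cur (adaptive_hbm A b z0 x0
      (fun j => T (tau j w)) (fun j => S (sig j w)) k) - mp_inverse A *m b) ^+ 2)%R]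
    = mean_x_error A b T S tau sig z0 x0 k)%E.
  rewrite unlock; apply: eq_integral => w _.
  by rewrite /= norm2_sqr.
rewrite orth_proj_complE !norm2_sqr; apply: (le_trans Ex).
rewrite lee_fin mulrDr; apply: lerD.
  by rewrite ler_wpM2r ?dotvv_ge0// lerXn2r ?nnegrE ?le_max ?rx0 ?lexx ?orbT.
rewrite mulrA ler_wpM2r ?dotvv_ge0// mulrCA ler_wpM2l//.
exact: mixed_geom_le.
Qed.
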